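(* Let $\mathcal B=(a,a,c,-c)\in(-2,2)^4$ satisfy (1) $a^2+c^2>4$, and (2) at least one of $\frac{\cos^{-1}(a/2)}{\pi}$, $\frac{\cos^{-1}(c/2)}{\pi}$ is irrational. Then the finite set $$\mathcal O=\{(a^2-2,0,0),\,(2-c^2,0,0)\}$$ is contained in $\mathcal M_{\mathcal B}(\mathrm{SL}(2,\mathbb R))^c$ (in trace coordinates $(x,y,z)$) and is $\Gamma$-invariant, and for every $\rho\in\mathcal H_{\mathcal B}(\mathrm{SL}(2,\mathbb R))$ whose class $[\rho]$ has coordinates $(a^2-2,0,0)$ or $(2-c^2,0,0)$, the image $\rho(\pi_1(M))$ is dense in $\mathrm{SL}(2,\mathbb R)$. In particular the $\Gamma$-orbit of $[\rho]$ is finite although $\rho(\pi_1(M))$ is dense in $\mathrm{SL}(2,\mathbb R)$.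
   Context: $M$ is a four-holed sphere with $\pi_1(M)=\langle A,B,C,D : ABCD=I\rangle$, where $A,B,C,D$ correspond to the four boundary components. Put $X=AB$, $Y=BC$, $Z=CA$. For $\mathcal B=(a,b,c,d)\in(-2,2)^4$, let $\mathcal H_{\mathcal B}(\mathrm{SL}(2,\mathbb R))$ be the set of completely reducible representations $\rho:\pi_1(M)\to\mathrm{SL}(2,\mathbb R)$ with $(\operatorname{tr}\rho(A),\operatorname{tr}\rho(B),\operatorname{tr}\rho(C),\operatorname{tr}\rho(D))=\mathcal B$, and $\mathcal M_{\mathcal B}(\mathrm{SL}(2,\mathbb R))$ its quotient by conjugation. Points of the moduli space are described by the global coordinates $(x,y,z)=(\operatorname{tr}\rho(X),\operatorname{tr}\rho(Y),\operatorname{tr}\rho(Z))\in\mathbb R^3$, which satisfy $$x^2+y^2+z^2+xyz=(ab+cd)x+(ad+bc)y+(ac+bd)z-(a^2+b^2+c^2+d^2+abcd-4).\quad( * )$$ With $I^{\pm}_{a,b}=\frac{ab\pm\sqrt{(a^2-4)(b^2-4)}}{2}$ and $I^{\pm}_{c,d}$ defined likewise: when the intervals $[I^-_{a,b},I^+_{a,b}]$ and $[I^-_{c,d},I^+_{c,d}]$ are disjoint, the compact component $\mathcal M_{\mathcal B}(\mathrm{SL}(2,\mathbb R))^c$ of $\mathcal M_{\mathcal B}(\mathrm{SL}(2,\mathbb R))$ is, in coordinates, the set of real solutions of $( * )$ whose $x$-coordinate lies in the closed interval between the two intervals ($[I^+_{a,b},I^-_{c,d}]$ or $[I^+_{c,d},I^-_{a,b}]$).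 $\Gamma$ is the mapping class group of $M$ fixing $\partial M$ (isotopy classes of diffeomorphisms of $M$ fixing $\partial M$). It acts by $\gamma(\rho)(W)=\rho(\gamma^{-1}(W))$ and preserves $\mathcal M_{\mathcal B}(\mathrm{SL}(2,\mathbb R))^c$. It is generated by the Dehn twists $\tau_X,\tau_Y$ in $X,Y$, which act in coordinates by $$\tau_X:(x,y,z)\mapsto(x,\;ad+bc-xz'-y,\;z'),\quad z'=ac+bd-xy-z,$$ $$\tau_Y:(x,y,z)\mapsto(x',\;y,\;ac+bd-yx'-z),\quad x'=ab+cd-yz-x.$$ *)

(* Defs.v *)
From HB Require Import structures.
From mathcomp Require Import all_boot all_order all_algebra.
From mathcomp Require Import all_classical all_reals all_analysis.

Set Implicit Arguments.
Unset Strict Implicit.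
Unset Printing Implicit Defensive.

Import Order.TTheory GRing.Theory Num.Theory.
Import numFieldNormedType.Exports.

Local Open Scope classical_set_scope.
Local Open Scope ring_scope.
Local Open Scope quotient_scope.

(** The letter [(i, false)] is the [i]-th generator (in the order A, B, C, D),
    and [(i, true)] is its inverse. *)
Definition letter := ('I_4 * bool)%type.
Definition word := seq letter.

Definition iA : 'I_4 := inord 0.
Definition iB : 'I_4 := inord 1.
Definition iC : 'I_4 := inord 2.
Definition iD : 'I_4 := inord 3.

Definition winv (w : word) : word := rev [seq (l.1, ~~ l.2) | l <- w].

(** The congruence on words generated by free cancellation and by the
    relator ABCD; [pi1] below is <A, B, C, D | ABCD = 1>. *)
Inductive word_eq : word -> word -> Prop :=
| word_eq_refl u : word_eq u u
| word_eq_sym u v : word_eq u v -> word_eq v u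
| word_eq_trans u v w : word_eq u v -> word_eq v w -> word_eq u w
| word_eq_cat u u' v v' :
    word_eq u u' -> word_eq v v' -> word_eq (u ++ v) (u' ++ v')
| word_eq_cancel (l : letter) : word_eq [:: l; (l.1, ~~ l.2)] [::]
| word_eq_relator :
    word_eq [:: (iA, false); (iB, false); (iC, false); (iD, false)] [::].

Definition word_eqb (u v : word) : bool := `[< word_eq u v >].

Lemma word_eqb_refl : reflexive word_eqb.
Proof. by move=> u; apply/asboolP; exact: word_eq_refl. Qed.

Lemma word_eqb_sym : symmetric word_eqb.
Proof. by move=> u v; apply/asboolP/asboolP; exact: word_eq_sym. Qed.

Lemma word_eqb_trans : transitive word_eqb.
Proof.
move=> v u w /asboolP uv /asboolP vw; apply/asboolP.
exact: word_eq_trans uv vw.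
Qed.

Canonical word_eqb_equiv :=
  EquivRel word_eqb word_eqb_refl word_eqb_sym word_eqb_trans.

Definition pi1 : Type := {eq_quot word_eqb}.
HB.instance Definition _ := EqQuotient.on pi1.
HB.instance Definition _ := Choice.on pi1.

Lemma pi1_eqP (u v : word) : \pi_pi1 u = \pi_pi1 v <-> word_eq u v.
Proof. by split=> [/eqmodP/asboolP|uv]; last by apply/eqmodP/asboolP. Qed.

Lemma repr_pi1 (w : word) : word_eq (repr (\pi_pi1 w)) w.
Proof. by apply/pi1_eqP; rewrite reprK. Qed.

Definition pi1_mul (p q : pi1) : pi1 := \pi_pi1 (repr p ++ repr q).
Definition pi1_one : pi1 := \pi_pi1 [::].
Definition pi1_inv (p : pi1) : pi1 := \pi_pi1 (winv (repr p)).

Lemma winvK : involutive winv.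
Proof.
move=> w; rewrite /winv map_rev revK -map_comp -[RHS]map_id.
by apply: eq_map => -[i b] /=; rewrite negbK.
Qed.

Lemma word_eq_catV (w : word) : word_eq (w ++ winv w) [::].
Proof.
elim: w => [|l w IH]; first exact: word_eq_refl.
rewrite /winv /= rev_cons -cats1 -/(winv w).
have -> : l :: w ++ winv w ++ [:: (l.1, ~~ l.2)]
    = ([:: l] ++ (w ++ winv w)) ++ [:: (l.1, ~~ l.2)].
  by rewrite /= -catA.
apply: word_eq_trans (word_eq_cancel l).
apply: (@word_eq_cat _ [:: l]); last exact: word_eq_refl.
by apply: (@word_eq_cat [:: l] [:: l] _ [::]) => //; exact: word_eq_refl.
Qed.

Lemma word_eq_catVw (w : word) : word_eq (winv w ++ w) [::].
Proof. by have := word_eq_catV (winv w); rewrite winvK. Qed.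

Lemma pi1_mulE (u v : word) :
  pi1_mul (\pi_pi1 u) (\pi_pi1 v) = \pi_pi1 (u ++ v).
Proof. by apply/pi1_eqP; apply: word_eq_cat; exact: repr_pi1. Qed.

Lemma pi1_mulA : associative pi1_mul.
Proof.
move=> p q r; rewrite -[p]reprK -[q]reprK -[r]reprK.
by rewrite (pi1_mulE (repr q)) (pi1_mulE (repr p)) (pi1_mulE (repr p))
  (pi1_mulE (_ ++ _)) catA.
Qed.

Lemma pi1_mul1 : left_id pi1_one pi1_mul.
Proof. by move=> p; rewrite -[p]reprK /pi1_one pi1_mulE. Qed.

Lemma pi1_mulr1 : right_id pi1_one pi1_mul.
Proof. by move=> p; rewrite -[p]reprK /pi1_one pi1_mulE cats0. Qed.

Lemma pi1_mulV : left_inverse pi1_one pi1_inv pi1_mul.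
Proof.
move=> p; rewrite /pi1_inv -{2}[p]reprK pi1_mulE.
by apply/pi1_eqP; exact: word_eq_catVw.
Qed.

Lemma pi1_mulrV : right_inverse pi1_one pi1_inv pi1_mul.
Proof.
move=> p; rewrite /pi1_inv -{1}[p]reprK pi1_mulE.
by apply/pi1_eqP; exact: word_eq_catV.
Qed.

HB.instance Definition _ := isGroup.Build pi1
  pi1_mulA pi1_mul1 pi1_mulr1 pi1_mulV pi1_mulrV.

Lemma pi1_catE (u v : word) :
  \pi_pi1 (u ++ v) = (\pi_pi1 u * \pi_pi1 v)%g.
Proof. by rewrite -pi1_mulE. Qed.

Definition gen (i : 'I_4) : pi1 := \pi_pi1 [:: (i, false)].
Notation gA := (gen iA).
Notation gB := (gen iB).
Notation gC := (gen iC).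
Notation gD := (gen iD).

Definition loopX : pi1 := (gA * gB)%g.
Definition loopY : pi1 := (gB * gC)%g.
Definition loopZ : pi1 := (gC * gA)%g.

Lemma pi1_relation : (gA * gB * gC * gD = 1 :> pi1)%g.
Proof.
rewrite /gen -!pi1_catE.
by apply/pi1_eqP; exact: word_eq_relator.
Qed.

Lemma pi1_VE (i : 'I_4) : \pi_pi1 [:: (i, true)] = ((gen i)^-1)%g.
Proof.
apply/(mulgI (gen i)); rewrite mulgV /gen -pi1_catE.
by apply/pi1_eqP; exact: (word_eq_cancel (i, false)).
Qed.

Definition letter_val (G : groupType) (f : 'I_4 -> G) (l : letter) : G :=
  if l.2 then ((f l.1)^-1)%g else f l.1.

Definition word_val (G : groupType) (f : 'I_4 -> G) (w : word) : G :=
  foldr (fun l g => (letter_val f l * g)%g) 1%g w.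

Lemma word_val_cat (G : groupType) (f : 'I_4 -> G) (u v : word) :
  word_val f (u ++ v) = (word_val f u * word_val f v)%g.
Proof. by elim: u => [|l u IH] /=; rewrite ?mul1g // IH mulgA. Qed.

Lemma word_val_eq (G : groupType) (f : 'I_4 -> G)
    (fR : (f iA * f iB * f iC * f iD)%g = 1%g) (u v : word) :
  word_eq u v -> word_val f u = word_val f v.
Proof.
elim=> //= {u v}.
- by move=> u v w _ -> _ ->.
- by move=> u u' v v' _ uE _ vE; rewrite !word_val_cat uE vE.
- by move=> [i []]; rewrite /letter_val /= mulg1 ?mulVg ?mulgV.
- by rewrite /letter_val /= mulg1 !mulgA.
Qed.

Definition pi1_lift (G : groupType) (f : 'I_4 -> G)
    (fR : (f iA * f iB * f iC * f iD)%g = 1%g) (p : pi1) : G :=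
  word_val f (repr p).

Lemma pi1_liftM (G : groupType) (f : 'I_4 -> G)
    (fR : (f iA * f iB * f iC * f iD)%g = 1%g) :
  {morph pi1_lift fR : p q / (p * q)%g}.
Proof.
move=> p q; rewrite /pi1_lift -word_val_cat.
exact: (word_val_eq fR (repr_pi1 _)).
Qed.

HB.instance Definition _ (G : groupType) (f : 'I_4 -> G)
    (fR : (f iA * f iB * f iC * f iD)%g = 1%g) :=
  isMultiplicative.Build pi1 G (pi1_lift fR) (pi1_liftM fR).

Lemma pi1_lift_gen (G : groupType) (f : 'I_4 -> G)
    (fR : (f iA * f iB * f iC * f iD)%g = 1%g) (i : 'I_4) :
  pi1_lift fR (gen i) = f i.
Proof.
by rewrite /pi1_lift (word_val_eq fR (repr_pi1 _)) /= /letter_val mulg1.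
Qed.

Lemma pi1_mor1 (G : groupType) (phi : {multiplicative pi1 -> G}) :
  phi 1%g = 1%g.
Proof. by apply: (mulgI (phi 1%g)); rewrite -gmulfM !mulg1. Qed.

Lemma pi1_morV (G : groupType) (phi : {multiplicative pi1 -> G}) (p : pi1) :
  phi (p^-1)%g = ((phi p)^-1)%g.
Proof.
by apply: (mulgI (phi p)); rewrite -gmulfM !mulgV pi1_mor1.
Qed.

Lemma pi1_mor_ext (G : groupType) (phi psi : {multiplicative pi1 -> G}) :
  (forall i, phi (gen i) = psi (gen i)) -> phi =1 psi.
Proof.
move=> phipsi p; rewrite -[p]reprK.
elim: (repr p) => [|[i b] w IH].
  by rewrite -[\pi_pi1 _]/(1%g : pi1) !pi1_mor1.
have -> : \pi_pi1 ((i, b) :: w) = (\pi_pi1 [:: (i, b)] * \pi_pi1 w)%g.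
  by rewrite -pi1_catE.
rewrite !gmulfM IH; congr (_ * _)%g; case: b; last exact: phipsi.
by rewrite pi1_VE !pi1_morV phipsi.
Qed.

Record pi1_aut := Pi1Aut {
  aut_fun :> {multiplicative pi1 -> pi1};
  aut_inv : {multiplicative pi1 -> pi1};
  aut_funK : cancel aut_fun aut_inv;
  aut_invK : cancel aut_inv aut_fun
}.

Definition aut_id : pi1_aut :=
  @Pi1Aut idfun idfun (fun=> erefl) (fun=> erefl).

Definition aut_comp (g h : pi1_aut) : pi1_aut :=
  @Pi1Aut (aut_fun g \o aut_fun h) (aut_inv h \o aut_inv g)
    (can_comp (aut_funK g) (aut_funK h)) (can_comp (aut_invK h) (aut_invK g)).

Definition aut_opp (g : pi1_aut) : pi1_aut :=
  @Pi1Aut (aut_inv g) (aut_fun g) (aut_invK g) (aut_funK g).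

Definition twist_gen (S : pred 'I_4) (h : pi1) (i : 'I_4) : pi1 :=
  if S i then (h * gen i * h^-1)%g else gen i.

Definition in_X : pred 'I_4 := [pred i | (i == iA) || (i == iB)].
Definition in_Y : pred 'I_4 := [pred i | (i == iB) || (i == iC)].

Lemma in_XE : (in_X iA = true) * (in_X iB = true) *
  (in_X iC = false) * (in_X iD = false).
Proof. by do !split; rewrite /in_X /= -!val_eqE /= !inordK. Qed.

Lemma in_YE : (in_Y iA = false) * (in_Y iB = true) *
  (in_Y iC = true) * (in_Y iD = false).
Proof. by do !split; rewrite /in_Y /= -!val_eqE /= !inordK. Qed.

Lemma twistX_relation (h : pi1) : (h * loopX = loopX * h)%g ->
  let f := twist_gen in_X h in (f iA * f iB * f iC * f iD)%g = 1%g.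
Proof.
move=> hX /=; rewrite /twist_gen !in_XE.
have -> : (h * gA * h^-1 * (h * gB * h^-1) = gA * gB)%g.
  have -> : (h * gA * h^-1 * (h * gB * h^-1) = h * loopX * h^-1)%g.
    by rewrite /loopX !mulgA mulgVK.
  by rewrite hX mulgK.
exact: pi1_relation.
Qed.

Lemma twistY_relation (h : pi1) : (h * loopY = loopY * h)%g ->
  let f := twist_gen in_Y h in (f iA * f iB * f iC * f iD)%g = 1%g.
Proof.
move=> hY /=; rewrite /twist_gen !in_YE.
have -> : (gA * (h * gB * h^-1) * (h * gC * h^-1) = gA * gB * gC)%g.
  have -> : (gA * (h * gB * h^-1) * (h * gC * h^-1)
             = gA * (h * loopY * h^-1))%g.
    by rewrite /loopY !mulgA mulgVK.
  by rewrite hY mulgK mulgA.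
exact: pi1_relation.
Qed.


Lemma comm_self_inv (h : pi1) : (h^-1 * h = h * h^-1)%g.
Proof. by rewrite mulVg mulgV. Qed.

Definition twistX : {multiplicative pi1 -> pi1} :=
  pi1_lift (@twistX_relation loopX erefl).
Definition twistXV : {multiplicative pi1 -> pi1} :=
  pi1_lift (@twistX_relation (loopX^-1)%g (comm_self_inv loopX)).
Definition twistY : {multiplicative pi1 -> pi1} :=
  pi1_lift (@twistY_relation loopY erefl).
Definition twistYV : {multiplicative pi1 -> pi1} :=
  pi1_lift (@twistY_relation (loopY^-1)%g (comm_self_inv loopY)).

Lemma twist_cancel (S : pred 'I_4) (h : pi1)
    (phi psi : {multiplicative pi1 -> pi1}) :
  (forall i, phi (gen i) = twist_gen S h i) ->
  (forall i, psi (gen i) = twist_gen S (h^-1)%g i) ->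
  psi h = h -> cancel phi psi.
Proof.
move=> phiE psiE psih.
apply: (@pi1_mor_ext _ (psi \o phi) idfun) => i /=.
rewrite phiE /twist_gen; case: ifP => Si; last by rewrite psiE /twist_gen Si.
by rewrite !gmulfM pi1_morV psih psiE /twist_gen Si invgK !mulgA mulgV mul1g
  mulgK.
Qed.

Lemma twistX_loopX (phi : {multiplicative pi1 -> pi1}) (h : pi1) :
  (h * loopX = loopX * h)%g ->
  (forall i, phi (gen i) = twist_gen in_X h i) -> phi loopX = loopX.
Proof.
move=> hX phiE; rewrite /loopX gmulfM !phiE /twist_gen !in_XE.
have -> : (h * gA * h^-1 * (h * gB * h^-1) = h * loopX * h^-1)%g.
  by rewrite /loopX !mulgA mulgVK.
by rewrite hX mulgK.
Qed.

Lemma twistY_loopY (phi : {multiplicative pi1 -> pi1}) (h : pi1) :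
  (h * loopY = loopY * h)%g ->
  (forall i, phi (gen i) = twist_gen in_Y h i) -> phi loopY = loopY.
Proof.
move=> hY phiE; rewrite /loopY gmulfM !phiE /twist_gen !in_YE.
have -> : (h * gB * h^-1 * (h * gC * h^-1) = h * loopY * h^-1)%g.
  by rewrite /loopY !mulgA mulgVK.
by rewrite hY mulgK.
Qed.

Lemma twistXE (i : 'I_4) : twistX (gen i) = twist_gen in_X loopX i.
Proof. exact: pi1_lift_gen. Qed.
Lemma twistXVE (i : 'I_4) : twistXV (gen i) = twist_gen in_X (loopX^-1)%g i.
Proof. exact: pi1_lift_gen. Qed.
Lemma twistYE (i : 'I_4) : twistY (gen i) = twist_gen in_Y loopY i.
Proof. exact: pi1_lift_gen. Qed.
Lemma twistYVE (i : 'I_4) : twistYV (gen i) = twist_gen in_Y (loopY^-1)%g i.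
Proof. exact: pi1_lift_gen. Qed.

Lemma twistXK : cancel twistX twistXV.
Proof.
apply: (twist_cancel twistXE twistXVE).
exact: twistX_loopX (comm_self_inv _) twistXVE.
Qed.

Lemma twistXVK : cancel twistXV twistX.
Proof.
apply: (twist_cancel twistXVE) => [i|]; first by rewrite invgK twistXE.
by rewrite pi1_morV (twistX_loopX _ twistXE).
Qed.

Lemma twistYK : cancel twistY twistYV.
Proof.
apply: (twist_cancel twistYE twistYVE).
exact: twistY_loopY (comm_self_inv _) twistYVE.
Qed.

Lemma twistYVK : cancel twistYV twistY.
Proof.
apply: (twist_cancel twistYVE) => [i|]; first by rewrite invgK twistYE.
by rewrite pi1_morV (twistY_loopY _ twistYE).
Qed.

(** With the base point on the boundary component of D, the Dehn twist in X
    conjugates A and B by X = AB and fixes C and D; the Dehn twist in Y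
    conjugates B and C by Y = BC and fixes A and D. *)
Definition tauX : pi1_aut := Pi1Aut twistXK twistXVK.
Definition tauY : pi1_aut := Pi1Aut twistYK twistYVK.

(** The mapping class group fixing the boundary, through its action on the
    fundamental group: the group generated by the two Dehn twists.  The twists
    along the boundary curves conjugate one generator by itself or act by an
    inner automorphism, hence act trivially on conjugacy classes of
    representations, and are left out. *)
Inductive mcg : pi1_aut -> Prop :=
| mcg_id : mcg aut_id
| mcg_tauX : mcg tauX
| mcg_tauY : mcg tauY
| mcg_comp (g h : pi1_aut) : mcg g -> mcg h -> mcg (aut_comp g h)
| mcg_inv (g : pi1_aut) : mcg g -> mcg (aut_opp g).

Record SL2 (R : realType) := MkSL2 {
  SL2_mx :> 'M[R]_2;
  SL2_det : \det SL2_mx == 1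
}.

HB.instance Definition _ (R : realType) := [isSub for @SL2_mx R].
HB.instance Definition _ (R : realType) := [Choice of SL2 R by <:].

Lemma SL2_mulP (R : realType) (g h : SL2 R) :
  \det ((g : 'M[R]_2) *m (h : 'M[R]_2)) == 1.
Proof. by rewrite det_mulmx (eqP (SL2_det g)) (eqP (SL2_det h)) mulr1. Qed.

Lemma SL2_oneP (R : realType) : \det (1%:M : 'M[R]_2) == 1.
Proof. by rewrite det1. Qed.

Lemma SL2_invP (R : realType) (g : SL2 R) : \det (invmx g) == 1.
Proof. by rewrite det_inv (eqP (SL2_det g)) invr1. Qed.

Definition SL2_mul (R : realType) (g h : SL2 R) := MkSL2 (SL2_mulP g h).
Definition SL2_one (R : realType) := MkSL2 (SL2_oneP R).
Definition SL2_inv (R : realType) (g : SL2 R) := MkSL2 (SL2_invP g).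

Lemma SL2_unit (R : realType) (g : SL2 R) : (g : 'M[R]_2) \in unitmx.
Proof. by rewrite unitmxE (eqP (SL2_det g)) unitr1. Qed.

Lemma SL2_mulA (R : realType) : associative (@SL2_mul R).
Proof. by move=> g h k; apply/val_inj; rewrite /= mulmxA. Qed.
Lemma SL2_mul1 (R : realType) : left_id (SL2_one R) (@SL2_mul R).
Proof. by move=> g; apply/val_inj; rewrite /= mul1mx. Qed.
Lemma SL2_mulr1 (R : realType) : right_id (SL2_one R) (@SL2_mul R).
Proof. by move=> g; apply/val_inj; rewrite /= mulmx1. Qed.
Lemma SL2_mulV (R : realType) :
  left_inverse (SL2_one R) (@SL2_inv R) (@SL2_mul R).
Proof. by move=> g; apply/val_inj; rewrite /= mulVmx ?SL2_unit. Qed.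
Lemma SL2_mulrV (R : realType) :
  right_inverse (SL2_one R) (@SL2_inv R) (@SL2_mul R).
Proof. by move=> g; apply/val_inj; rewrite /= mulmxV ?SL2_unit. Qed.

HB.instance Definition _ (R : realType) := isGroup.Build (SL2 R)
  (@SL2_mulA R) (@SL2_mul1 R) (@SL2_mulr1 R) (@SL2_mulV R) (@SL2_mulrV R).

HB.instance Definition _ (R : realType) :=
  Topological.copy (SL2 R) (initial_topology (@SL2_mx R)).

Definition SL2_tr (R : realType) (g : SL2 R) : R := \tr (g : 'M[R]_2).

Definition rep (R : realType) : Type := {multiplicative pi1 -> SL2 R}.
HB.instance Definition _ (R : realType) := gen_eqMixin (rep R).
HB.instance Definition _ (R : realType) := gen_choiceMixin (rep R).

(** [U] is invariant under the action of [rho] on column vectors; subspaces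
    are encoded as row spaces, whence the transpose. *)
Definition invariant (R : realType) (rho : rep R) (U : 'M[R]_2) : Prop :=
  forall p : pi1, stablemx U (rho p : 'M[R]_2)^T.

Definition completely_reducible (R : realType) (rho : rep R) : Prop :=
  forall U : 'M[R]_2, invariant rho U ->
  exists W : 'M[R]_2,
    [/\ invariant rho W, (U + W :=: 1%:M)%MS & mxdirect (U + W)].

Definition boundary_traces (R : realType) (rho : rep R) : R * R * R * R :=
  (SL2_tr (rho gA), SL2_tr (rho gB), SL2_tr (rho gC), SL2_tr (rho gD)).

Definition boundary_reps (R : realType) (B : R * R * R * R) : set (rep R) :=
  [set rho | completely_reducible rho /\ boundary_traces rho = B].

Definition conj_rep (R : realType) (rho sigma : rep R) : Prop :=
  exists g : SL2 R, forall p : pi1, sigma p = (g * rho p * g^-1)%g.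

Definition conj_repb (R : realType) (rho sigma : rep R) : bool :=
  `[< conj_rep rho sigma >].

Lemma conj_repb_refl (R : realType) : reflexive (@conj_repb R).
Proof.
by move=> rho; apply/asboolP; exists 1%g => p; rewrite mul1g invg1 mulg1.
Qed.

Lemma conj_rep_sym (R : realType) (rho sigma : rep R) :
  conj_rep rho sigma -> conj_rep sigma rho.
Proof.
move=> [g gE]; exists (g^-1)%g => p.
by rewrite gE invgK !mulgA mulVg mul1g mulgVK.
Qed.

Lemma conj_repb_sym (R : realType) : symmetric (@conj_repb R).
Proof. by move=> rho sigma; apply/asboolP/asboolP; exact: conj_rep_sym. Qed.

Lemma conj_repb_trans (R : realType) : transitive (@conj_repb R).
Proof.
move=> sigma rho theta /asboolP[g gE] /asboolP[h hE]; apply/asboolP.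
by exists (h * g)%g => p; rewrite hE gE invgM !mulgA.
Qed.

Canonical conj_repb_equiv (R : realType) :=
  EquivRel (@conj_repb R) (@conj_repb_refl R) (@conj_repb_sym R)
    (@conj_repb_trans R).

Definition rep_class (R : realType) : Type := {eq_quot (@conj_repb R)}.
HB.instance Definition _ (R : realType) := EqQuotient.on (rep_class R).
HB.instance Definition _ (R : realType) := Choice.on (rep_class R).

Definition class_of (R : realType) (rho : rep R) : rep_class R :=
  \pi_(rep_class R) rho.

(** Conjugacy is by SL(2, R) itself, not by GL(2, R): [coords] may identify a
    class with its image under an orientation-reversing conjugation. *)
Definition moduli (R : realType) (B : R * R * R * R) : set (rep_class R) :=
  [set class_of rho | rho in boundary_reps B].

Definition rep_coords (R : realType) (rho : rep R) : R * R * R :=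
  (SL2_tr (rho loopX), SL2_tr (rho loopY), SL2_tr (rho loopZ)).

Definition coords (R : realType) (m : rep_class R) : R * R * R :=
  rep_coords (repr m).
Arguments coords {R} m.

Definition rep_act (R : realType) (g : pi1_aut) (rho : rep R) : rep R :=
  rho \o aut_inv g.

Definition act (R : realType) (g : pi1_aut) (m : rep_class R) : rep_class R :=
  class_of (rep_act g (repr m)).

Lemma class_ofP (R : realType) (rho sigma : rep R) :
  class_of rho = class_of sigma <-> conj_rep rho sigma.
Proof. by split=> [/eqmodP/asboolP|cj]; last by apply/eqmodP/asboolP. Qed.

Lemma repr_classP (R : realType) (rho : rep R) :
  conj_rep (repr (class_of rho)) rho.
Proof. by apply/class_ofP; rewrite /class_of reprK. Qed.

Lemma SL2_tr_conj (R : realType) (g h : SL2 R) :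
  SL2_tr (g * h * g^-1)%g = SL2_tr h.
Proof.
by rewrite /SL2_tr /= mxtrace_mulC mulmxA mulVmx ?SL2_unit // mul1mx.
Qed.

Lemma coordsE (R : realType) (rho : rep R) :
  coords (class_of rho) = rep_coords rho.
Proof.
have [g gE] := conj_rep_sym (repr_classP rho).
by rewrite /coords /rep_coords !gE !SL2_tr_conj.
Qed.

Lemma actE (R : realType) (g : pi1_aut) (rho : rep R) :
  act g (class_of rho) = class_of (rep_act g rho).
Proof.
apply/class_ofP; have [h hE] := repr_classP rho.
by exists h => p; exact: hE.
Qed.

Definition mcg_orbit (R : realType) (m : rep_class R) : set (rep_class R) :=
  [set act g m | g in mcg].

Definition trace_cubic (R : realType) (B : R * R * R * R) : set (R * R * R) :=
  [set p | let: (a, b, c, d) := B in let: (x, y, z) := p in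
    x ^+ 2 + y ^+ 2 + z ^+ 2 + x * y * z =
      (a * b + c * d) * x + (a * d + b * c) * y + (a * c + b * d) * z
      - (a ^+ 2 + b ^+ 2 + c ^+ 2 + d ^+ 2 + a * b * c * d - 4)].

Definition Iplus (R : realType) (a b : R) : R :=
  (a * b + Num.sqrt ((a ^+ 2 - 4) * (b ^+ 2 - 4))) / 2.
Definition Iminus (R : realType) (a b : R) : R :=
  (a * b - Num.sqrt ((a ^+ 2 - 4) * (b ^+ 2 - 4))) / 2.

(** The closed interval between [Iminus a b, Iplus a b] and
    [Iminus c d, Iplus c d]; empty if these two intervals meet. *)
Definition gap (R : realType) (B : R * R * R * R) : set R :=
  [set x | let: (a, b, c, d) := B in
    (Iplus a b < Iminus c d /\ Iplus a b <= x <= Iminus c d) \/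
    (Iplus c d < Iminus a b /\ Iplus c d <= x <= Iminus a b)].

(** The compact part of the moduli space is described through its trace
    coordinates; since [moduli] distinguishes orientations it is the full
    preimage of the compact component of the cubic surface. *)
Definition compact_component (R : realType) (B : R * R * R * R) :
    set (rep_class R) :=
  [set m | [/\ moduli B m, trace_cubic B (coords m)
             & gap B (coords m).1.1]].

(* Main.v *)
Require Import Defs.
From HB Require Import structures.
From mathcomp Require Import all_boot all_order all_algebra.
From mathcomp Require Import all_classical all_reals all_analysis.
From mathcomp Require Import ring lra.
Import Order.TTheory GRing.Theory Num.Theory.
Import numFieldNormedType.Exports.
Local Open Scope classical_set_scope.
Local Open Scope ring_scope.
Set Implicit Arguments.
Unset Strict Implicit.
Unset Printing Implicit Defensive.

(** On the locus y = z = 0 of the cubic with boundary traces (a, a, c, -c), the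
    twist in X is the identity and the twist in Y exchanges the two roots
    x = a^2 - 2 and x = 2 - c^2.  At the first root B = A, so a class is
    determined by the elliptic pair (A, C) with tr(CA) = 0; normalising A to a
    rotation by +-acos(a/2) and C by a Cartan decomposition leaves at most two
    classes, and the twist in Y carries the classes over one root to those over
    the other.

    For density, conjugate whichever of A, C is an irrational rotation into
    SO(2): its powers are dense there, so the closure of the image contains
    SO(2).  The other generator is not in SO(2), since commuting elements would
    force a^2 + c^2 = 4, and SO(2) is a maximal proper subgroup of SL(2, R). *)


(** * Preliminaries on closures, continuity and 2x2 determinants *)

Lemma ord2P (i : 'I_2) : i = 0 \/ i = 1.
Proof. by case: i => [[|[|//]] ?]; [left|right]; exact: val_inj. Qed.

Lemma continuous_mx (K : numFieldType) (T : topologicalType) (m n : nat)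
    (F : T -> 'M[K]_(m, n)) :
  (forall i j, continuous (fun t => F t i j)) -> continuous F.
Proof.
move=> Fc t A [P FP PA].
have : \forall s \near t, forall i j, P i j (F s i j).
  apply: filter_forall => i; apply: filter_forall => j.
  exact: Fc (FP i j).
by apply: filterS => s Ps; exact: PA.
Qed.

(** Asking [f y] to lie only in the closure of [B] lets the lemma be applied to one variable after
    another. *)
Lemma closure_continuous (T U : topologicalType) (f : T -> U) (A : set T)
    (B : set U) (x : T) :
  continuous f -> (forall y, A y -> closure B (f y)) -> closure A x ->
  closure B (f x).
Proof.
move=> fc AB Ax; rewrite (iffLR (closure_id _) (@closed_closure _ B)).
move=> V fxV; have [y [Ay Vy]] := Ax _ (fc x V fxV).
by exists (f y); split => //; exact: AB.
Qed.

Lemma continuous_lincomb (K : numFieldType) (T : topologicalType)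
    (a b : K) (u v : T -> K) :
  continuous u -> continuous v -> continuous (fun t => a * u t + b * v t).
Proof.
move=> uc vc t.
by apply: cvgD; apply: cvgM; (try exact: cvg_cst); [exact: uc|exact: vc].
Qed.

Lemma det_mx22 (K : comRingType) (M : 'M[K]_2) :
  \det M = M 0 0 * M 1 1 - M 0 1 * M 1 0.
Proof.
have l01 : lift (0 : 'I_2) (ord0 : 'I_1) = 1 by exact: val_inj.
have l10 : lift (1 : 'I_2) (ord0 : 'I_1) = 0 by exact: val_inj.
rewrite (expand_det_row _ 0) big_ord_recl big_ord1 /cofactor !det_mx11 !mxE /=.
rewrite -[0 : 'I_1]/(ord0 : 'I_1) !(l01, l10).
by rewrite expr0 mul1r expr1 mulN1r mulrN.
Qed.

(** * Entries, traces and topology of SL(2, R) *)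

Section SL2.
Context {R : realType}.
Implicit Types (g h : SL2 R).

Lemma SL2_ext g h : g 0 0 = h 0 0 -> g 0 1 = h 0 1 -> g 1 0 = h 1 0 ->
  g 1 1 = h 1 1 -> g = h.
Proof.
move=> *; apply/val_inj/matrixP => i j.
by case: (ord2P i) => ->; case: (ord2P j) => ->.
Qed.

Lemma mulSL2E g h i j : (g * h)%g i j = g i 0 * h 0 j + g i 1 * h 1 j.
Proof.
rewrite [LHS]mxE big_ord_recl big_ord1.
by congr (_ + g i _ * h _ j); exact: val_inj.
Qed.

Lemma oneSL2E i j : (1%g : SL2 R) i j = (i == j)%:R.
Proof. by rewrite mxE. Qed.

Lemma trSL2E g : SL2_tr g = g 0 0 + g 1 1.
Proof.
rewrite /SL2_tr /mxtrace big_ord_recl big_ord1.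
by congr (_ + g _ _); exact: val_inj.
Qed.

Lemma detSL2E g : g 0 0 * g 1 1 - g 0 1 * g 1 0 = 1.
Proof. by rewrite -det_mx22; exact/eqP/SL2_det. Qed.

Definition mx22 (p q r s : R) : 'M[R]_2 :=
  \matrix_(i, j) if i == 0 then if j == 0 then p else q
                 else if j == 0 then r else s.

Lemma mx22_det (p q r s : R) : p * s - q * r = 1 -> \det (mx22 p q r s) == 1.
Proof. by move=> E; rewrite det_mx22 !mxE /= E. Qed.

Definition sl2 (p q r s : R) (E : p * s - q * r = 1) := MkSL2 (mx22_det E).

Lemma sl2E p q r s (E : p * s - q * r = 1) :
  (sl2 E 0 0 = p) * (sl2 E 0 1 = q) * (sl2 E 1 0 = r) * (sl2 E 1 1 = s).
Proof. by rewrite !mxE. Qed.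

Lemma sl2_invP g : g 1 1 * g 0 0 - (- g 0 1) * (- g 1 0) = 1.
Proof. by rewrite -[RHS](detSL2E g); ring. Qed.

Lemma invSL2 g : (g^-1)%g = sl2 (sl2_invP g).
Proof.
have E := detSL2E g.
apply: (mulgI g); rewrite mulgV.
apply: SL2_ext; rewrite mulSL2E !sl2E oneSL2E /=; try ring; rewrite -E; ring.
Qed.

Lemma invSL2E g : ((g^-1)%g 0 0 = g 1 1) * ((g^-1)%g 0 1 = - g 0 1) *
  ((g^-1)%g 1 0 = - g 1 0) * ((g^-1)%g 1 1 = g 0 0).
Proof. by rewrite invSL2 !sl2E. Qed.

Lemma SL2_tr1 : SL2_tr (1%g : SL2 R) = 2.
Proof. by rewrite trSL2E !oneSL2E. Qed.

Lemma SL2_trV g : SL2_tr (g^-1)%g = SL2_tr g.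
Proof. by rewrite !trSL2E !invSL2E addrC. Qed.

Lemma SL2_trC g h : SL2_tr (g * h)%g = SL2_tr (h * g)%g.
Proof. by rewrite !trSL2E !mulSL2E; ring. Qed.

(** Cayley-Hamilton in the form g + g^-1 = tr(g) 1, multiplied by h. The trace identities for words
    below rest on it. *)
Lemma SL2_trM g h :
  SL2_tr (g * h)%g = SL2_tr g * SL2_tr h - SL2_tr (g^-1 * h)%g.
Proof. by rewrite !trSL2E !mulSL2E !invSL2E; ring. Qed.

Lemma SL2_continuous_entries (T : topologicalType) (F : T -> SL2 R) :
  (forall i j, continuous (fun t => F t i j)) -> continuous F.
Proof. by move=> Fc; apply: continuous_comp_initial; exact: continuous_mx. Qed.

Lemma SL2_entry_continuous i j : continuous (fun g => g i j).
Proof.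
move=> g A gA.
apply: (@initial_continuous _ _ (@SL2_mx R) g [set M : 'M[R]_2 | A (M i j)]).
exact: (@coord_continuous R 2 2 i j).
Qed.

Lemma SL2_translation_continuous h k : continuous (fun g => h * g * k)%g.
Proof.
apply: SL2_continuous_entries => i j.
have ec i' j' : continuous (fun g => g i' j') by exact: SL2_entry_continuous.
rewrite (_ : (fun _ => _) = fun g =>
  k 0 j * (h i 0 * g 0 0 + h i 1 * g 1 0) +
  k 1 j * (h i 0 * g 0 1 + h i 1 * g 1 1)); last first.
  by apply/funext => g; rewrite !mulSL2E; ring.
by do 2!apply: continuous_lincomb.
Qed.

(** Translations are continuous, so the factors are approximated from [S] one at a time: first [h],
    then [g]. *)
Lemma closure_SL2M (S : set (SL2 R)) :
  (forall g h, S g -> S h -> S (g * h)%g) ->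
  forall g h, closure S g -> closure S h -> closure S (g * h)%g.
Proof.
move=> SM g h Sg Sh.
rewrite -[(g * h)%g]mulg1.
apply: (closure_continuous (@SL2_translation_continuous g 1%g) _ Sh) => k Sk.
rewrite mulg1 -[(g * k)%g]mul1g mulgA.
apply: (closure_continuous (@SL2_translation_continuous 1%g k) _ Sg) => l Sl.
by apply: subset_closure; rewrite mul1g; exact: SM.
Qed.
End SL2.


(** * Cartan decomposition and maximality of SO(2) *)

Section Rotation.
Context {R : realType}.
Implicit Types (g h : SL2 R) (b s t u v : R).

Lemma rot_det t : cos t * cos t - (- sin t) * sin t = 1.
Proof. by rewrite mulNr opprK -!expr2 cos2Dsin2. Qed.

Definition rot t : SL2 R := sl2 (rot_det t).

Lemma rotE t : (rot t 0 0 = cos t) * (rot t 0 1 = - sin t) *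
  (rot t 1 0 = sin t) * (rot t 1 1 = cos t).
Proof. exact: sl2E. Qed.

Lemma rotD s t : rot (s + t) = (rot s * rot t)%g.
Proof.
by apply: SL2_ext; rewrite mulSL2E !rotE ?cosD ?sinD; ring.
Qed.

Lemma rot0 : rot 0 = 1%g.
Proof.
by apply: SL2_ext; rewrite rotE oneSL2E /= ?cos0 ?sin0 ?oppr0.
Qed.

Lemma rotN t : rot (- t) = (rot t)^-1%g.
Proof. by apply: (mulgI (rot t)); rewrite -rotD subrr rot0 mulgV. Qed.

Lemma rot_continuous : continuous rot.
Proof.
apply: SL2_continuous_entries => i j.
case: (ord2P i) => ->; case: (ord2P j) => ->.
- by under eq_fun do rewrite rotE; exact: continuous_cos.
- under eq_fun do rewrite rotE.
  by move=> t; apply: continuousN; exact: continuous_sin.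
- by under eq_fun do rewrite rotE; exact: continuous_sin.
- by under eq_fun do rewrite rotE; exact: continuous_cos.
Qed.

Lemma unit_circle_angle u v : u ^+ 2 + v ^+ 2 = 1 ->
  exists t, cos t = u /\ sin t = v.
Proof.
move=> uv1.
have u1 : -1 <= u <= 1 by apply/andP; split; nra.
have su : Num.sqrt (1 - u ^+ 2) = `|v| by rewrite -uv1 addrC addKr sqrtr_sqr.
have [v0|v0] := leP 0 v.
  by exists (acos u); rewrite acosK ?in_itv// sin_acos// su ger0_norm.
exists (- acos u); rewrite cosN sinN acosK ?in_itv// sin_acos// su.
by rewrite ltr0_norm// opprK.
Qed.

Lemma polar_angle u v : exists t,
  u = Num.sqrt (u ^+ 2 + v ^+ 2) * cos t /\
  v = Num.sqrt (u ^+ 2 + v ^+ 2) * sin t.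
Proof.
have uv0 : 0 <= u ^+ 2 + v ^+ 2 by rewrite addr_ge0 ?sqr_ge0.
set r := Num.sqrt _; have r2 : r ^+ 2 = u ^+ 2 + v ^+ 2 by rewrite sqr_sqrtr.
have [r0|r0] := eqVneq r 0.
  exists 0; rewrite r0 !mul0r; move: r2; rewrite r0 expr0n /=.
  move=> /esym/eqP; rewrite paddr_eq0 ?sqr_ge0// !sqrf_eq0.
  by case/andP => /eqP -> /eqP ->.
have [|t [ct st]] := @unit_circle_angle (u / r) (v / r).
  by rewrite !expr_div_n -mulrDl -r2 divff// sqrf_eq0.
by exists t; rewrite ct st; split; field.
Qed.

(** In the coordinates [z |-> alpha z + beta z^*] of a real 2x2 matrix acting
    on the complex line, rotations are [beta = 0] and [displ g] is [|beta|]. *)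
Definition displ g : R :=
  Num.sqrt (((g 0 0 - g 1 1) / 2) ^+ 2 + ((g 1 0 + g 0 1) / 2) ^+ 2).

Lemma hyp_det b : (Num.sqrt (1 + b ^+ 2) + b) * (Num.sqrt (1 + b ^+ 2) - b)
  - 0 * 0 = 1.
Proof.
have := @sqr_sqrtr _ (1 + b ^+ 2); rewrite addr_ge0 ?sqr_ge0// => /(_ isT).
set w := Num.sqrt _ => w2; rewrite (_ : _ - _ = w ^+ 2 - b ^+ 2); last by ring.
by rewrite w2; ring.
Qed.

(** The diagonal matrix with entries e^s and e^-s for b = sinh s, where [Num.sqrt (1 + b ^+ 2)] is
    cosh s. With this parameter its displacement is |b|. *)
Definition hyp b : SL2 R := sl2 (hyp_det b).

(** Let alpha and beta have arguments phi and psi. The product [rot s * hyp d * rot t] has alpha of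
    argument s + t and beta of argument s - t, so half the sum and half the difference solve for s
    and t. The moduli agree because det g = 1 reads |alpha|^2 - |beta|^2 = 1. *)
Lemma cartan_decomposition g : exists s t,
  g = (rot s * hyp (displ g) * rot t)%g.
Proof.
have [phi [a1 a2]] := polar_angle ((g 0 0 + g 1 1) / 2) ((g 1 0 - g 0 1) / 2).
have [psi [b1 b2]] := polar_angle ((g 0 0 - g 1 1) / 2) ((g 1 0 + g 0 1) / 2).
move: b1 b2; rewrite -/(displ g) => b1 b2.
have d2 : displ g ^+ 2 =
    ((g 0 0 - g 1 1) / 2) ^+ 2 + ((g 1 0 + g 0 1) / 2) ^+ 2.
  by rewrite sqr_sqrtr// addr_ge0 ?sqr_ge0.
have c2 : ((g 0 0 + g 1 1) / 2) ^+ 2 + ((g 1 0 - g 0 1) / 2) ^+ 2 =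
    1 + displ g ^+ 2 by rewrite d2; have := detSL2E g; lra.
move: a1 a2; rewrite c2.
set w := Num.sqrt _ => a1 a2.
exists ((phi + psi) / 2), ((phi - psi) / 2).
set S := (phi + psi) / 2; set T := (phi - psi) / 2.
have phiE : phi = S + T by rewrite /S /T; field.
have psiE : psi = S + - T by rewrite /S /T; field.
have hypE : (hyp (displ g) 0 0 = w + displ g) * (hyp (displ g) 0 1 = 0) *
  (hyp (displ g) 1 0 = 0) * (hyp (displ g) 1 1 = w - displ g) by exact: sl2E.
rewrite phiE cosD sinD in a1 a2; rewrite psiE cosD sinD cosN sinN in b1 b2.
by apply: SL2_ext; rewrite !mulSL2E !hypE !rotE; lra.
Qed.

(** The beta coefficient of the product is w b (e^(it) + e^(-it)) with w = sqrt(1 + b^2). *)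
Lemma displ_hyp_rot_hyp b t : 0 <= b ->
  displ (hyp b * rot t * hyp b)%g = 2 * b * Num.sqrt (1 + b ^+ 2) * `|cos t|.
Proof.
move=> b0; rewrite /displ !mulSL2E !rotE !sl2E; set w := Num.sqrt (1 + _).
transitivity (Num.sqrt ((2 * b * w * cos t) ^+ 2)).
  by congr Num.sqrt; field.
by rewrite sqrtr_sqr !normrM (ger0_norm b0) normr_nat (ger0_norm (sqrtr_ge0 _)).
Qed.

(** The products [hyp b * rot t * hyp b] reach every displacement up to [2 b],
    so by doubling a submonoid beyond the rotations reaches all of them. *)
Lemma rot_maximal (H : set (SL2 R)) g :
  (forall h k, H h -> H k -> H (h * k)%g) -> (forall t, H (rot t)) ->
  H g -> displ g != 0 -> forall h, H h.
Proof.
move=> HM Hrot Hg dg.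
have Hhyp h : H h -> H (hyp (displ h)).
  move=> Hh; have [s [t hE]] := cartan_decomposition h.
  have -> : hyp (displ h) = (rot (- s) * h * rot (- t))%g.
    by rewrite {2}hE !rotN !mulgA mulVg mul1g mulgK.
  by apply: (HM _ _ _ (Hrot _)); exact: (HM _ _ (Hrot _) Hh).
have dbl b f : 0 < b -> H (hyp b) -> 0 <= f <= 2 * b -> H (hyp f).
  move=> b0 Hb /andP[f0 fb].
  have w1 : 1 <= Num.sqrt (1 + b ^+ 2).
    by rewrite -[leLHS]sqrtr1 ler_wsqrtr// lerDl sqr_ge0.
  set w := Num.sqrt _ in w1; have w0 : 0 < w by lra.
  (* The cosine of the middle angle for which the product has displacement exactly [f]. Since w >=
     1, it lies in [0, 1] whenever f <= 2b. *)
  set x := f / (2 * b * w).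
  have x01 : 0 <= x <= 1.
    have bw0 : 0 < 2 * b * w by rewrite !mulr_gt0.
    rewrite divr_ge0 ?(ltW bw0)//= ler_pdivrMr// mul1r.
    by apply: (le_trans fb); rewrite ler_peMr// mulr_ge0// ltW.
  have := Hhyp (hyp b * rot (acos x) * hyp b)%g.
  rewrite displ_hyp_rot_hyp ?ltW// -/w acosK; last by rewrite in_itv /=; lra.
  rewrite ger0_norm; last by lra.
  rewrite (_ : _ * x = f); last by rewrite /x; field; rewrite !gt_eqF.
  by apply; apply: (HM _ _ _ Hb); exact: (HM _ _ Hb (Hrot _)).
set b := displ g; have b0 : 0 < b by rewrite lt_def dg sqrtr_ge0.
have Hpow n : H (hyp (2 ^+ n * b)).
  elim: n => [|n IHn]; first by rewrite mul1r; exact: Hhyp.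
  apply: (dbl _ _ _ IHn); first by rewrite mulr_gt0 ?exprn_gt0.
  by rewrite exprS -mulrA lexx andbT !mulr_ge0 ?exprn_ge0// ltW.
move=> h; have [s [t ->]] := cartan_decomposition h.
apply: (HM _ _ _ (Hrot _)); apply: (HM _ _ (Hrot _)).
set f := displ h; have f0 : 0 <= f by exact: sqrtr_ge0.
(* Enough doublings to pass [f]: the Archimedean bound n exceeds f / b, and n < 2^n. *)
apply: (dbl (2 ^+ Num.bound (f / b) * b)); [|exact: Hpow|].
  by rewrite mulr_gt0 ?exprn_gt0.
rewrite f0 /=.
have fb : f / b <= 2 ^+ Num.bound (f / b).
  apply: (le_trans (ltW (archi_boundP _))); first by rewrite divr_ge0// ltW.
  by rewrite -natrX ler_nat ltnW// ltn_expl.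
move: fb; rewrite ler_pdivrMr// => fb; apply: (le_trans fb).
by rewrite ler_peMl ?ler1n// mulr_ge0 ?exprn_ge0// ltW.
Qed.
End Rotation.


(** * Additive subgroups of the real line: discrete or dense *)

Section RealSubgroup.
Context {R : realType}.
Implicit Types (G : set R) (x y d e : R).

Lemma real_subgroup_multiples G x (n : int) :
  (forall u v, G u -> G v -> G (u - v)) -> G x -> G (n%:~R * x).
Proof.
move=> GB Gx.
have G0 : G 0 by rewrite -(subrr x); exact: GB.
have GN u : G u -> G (- u) by move=> Gu; rewrite -[- u]add0r; exact: GB.
have Gn (k : nat) : G (k%:R * x).
  elim: k => [|k IHk]; first by rewrite mul0r.
  by rewrite -addn1 natrD mulrDl mul1r -[x in _ + x]opprK; exact/GB/GN.
by case: n => k; [exact: Gn|rewrite NegzE rmorphN mulNr; exact/GN/Gn].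
Qed.

(** A positive element [d] within [e] of the infimum of the positive elements is already the least
    one: a smaller one would differ from it by less than [e]. Division with remainder by [d] then
    leaves remainder 0. *)
Lemma real_subgroup_discrete G x e :
  (forall u v, G u -> G v -> G (u - v)) -> G x -> 0 < x -> 0 < e ->
  (forall u, G u -> 0 < u -> e <= u) ->
  exists d, 0 < d /\ forall u, G u -> exists n : int, u = n%:~R * d.
Proof.
move=> GB Gx x0 e0 Ge; pose P := G `&` [set u | 0 < u].
have infP : has_inf P by split; [exists x|exists e => u [Gu u0]; exact: Ge].
have P_ge u : P u -> inf P <= u by case: infP => _ lbP; exact: ge_inf lbP u.
have [d [Gd d0] dlt] := inf_adherent e0 infP.
have dmin u : P u -> d <= u.
  move=> Pu; rewrite leNgt; apply/negP => ud.
  have := Ge (d - u) (GB _ _ Gd Pu.1); rewrite subr_gt0 => /(_ ud).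
  by have := P_ge _ Pu; lra.
exists d; split => // u Gu; exists (Num.floor (u / d)).
have Gr : G (u - (Num.floor (u / d))%:~R * d).
  by apply: (GB _ _ Gu); apply: real_subgroup_multiples.
have /andP[lo hi] := floor_itv (u / d).
move: lo hi; rewrite ler_pdivlMr// ltr_pdivrMr// intrD mulrDl mul1r => lo hi.
apply/eqP; rewrite -subr_eq0 eq_le subr_ge0 lo andbT leNgt; apply/negP => r0.
by have := dmin _ (conj Gr r0); lra.
Qed.

(** If some positive element is below [e], a multiple of it comes within [e] of [z]. Otherwise the
    subgroup is cyclic and x / y is a quotient of integers. *)
Lemma real_subgroup_dense G x y :
  (forall u v, G u -> G v -> G (u - v)) -> G x -> G y -> 0 < y ->
  irrational (x / y) -> forall z, closure G z.
Proof.
move=> GB Gx Gy y0 xy z V /nbhs_ballP[e /= e0 eV].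
have [[g [Gg g0 ge]]|small] :=
    pselect (exists g, [/\ G g, 0 < g & g < e]).
  exists ((Num.floor (z / g))%:~R * g).
  split; first exact: real_subgroup_multiples.
  apply: eV; rewrite /ball /= ger0_norm.
    have /andP[_] := floor_itv (z / g).
    by rewrite ltr_pdivrMr// intrD mulrDl mul1r; lra.
  have /andP[+ _] := floor_itv (z / g).
  by rewrite ler_pdivlMr// subr_ge0.
have [|d [d0 dG]] := @real_subgroup_discrete G y e GB Gy y0 e0.
  move=> u Gu u0; rewrite leNgt; apply/negP => ue.
  by apply: small; exists u.
exfalso; apply: xy.
have [n xE] := dG _ Gx; have [m yE] := dG _ Gy.
have d_neq0 : d != 0 by rewrite gt_eqF.
exists (n%:~R / m%:~R) => //.
by rewrite fmorph_div/= !ratr_int xE yE -mulf_div divff// mulr1.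
Qed.
End RealSubgroup.

(** * Density of groups containing an irrational elliptic element *)

Section Density.
Context {R : realType}.
Implicit Types (g h k x : SL2 R) (S : set (SL2 R)).

Lemma rot2pi : rot (pi *+ 2) = 1%g :> SL2 R.
Proof. by apply: SL2_ext; rewrite rotE oneSL2E /= ?cos2pi ?sin2pi ?oppr0. Qed.

(** The columns of the conjugator come from the fixed point of [g] in the
    upper half-plane. *)
Lemma elliptic_conj_rot g : -2 < SL2_tr g < 2 ->
  exists k t, g = (k * rot t * k^-1)%g /\
    (t = acos (SL2_tr g / 2) \/ t = - acos (SL2_tr g / 2)).
Proof.
move=> gtr; have gdet := detSL2E g.
have u1 : -1 <= SL2_tr g / 2 <= 1 by lra.
set u := SL2_tr g / 2; set w := Num.sqrt (1 - u ^+ 2).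
have w0 : 0 < w by rewrite sqrtr_gt0 /u; nra.
have w2 : w ^+ 2 = 1 - u ^+ 2 by rewrite sqr_sqrtr// ltW// -sqrtr_gt0.
have ca : cos (acos u) = u by rewrite acosK ?in_itv.
have sa : sin (acos u) = w by rewrite sin_acos.
have r0 : g 1 0 != 0.
  apply/eqP => r0; move: gdet gtr; rewrite r0 trSL2E mulr0 subr0.
  set p := g 0 0; set q := g 1 1 => pq.
  by have := sqr_ge0 (p - q); nra.
(* The sign of the angle is that of [g 1 0], so that sin t / g 1 0 is positive and has a square
   root. It records which of two orientations the rotation has, and conjugation in SL(2, R) cannot
   change it. *)
have [t [ct st rt tE]] : exists t, [/\ cos t = u, sin t ^+ 2 = 1 - u ^+ 2,
    0 < sin t / g 1 0 & t = acos u \/ t = - acos u].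
  case: (ltrgtP (g 1 0) 0) r0 => // r0 _.
    exists (- acos u); rewrite cosN sinN ca sa sqrrN; split=> //; last by right.
    by rewrite mulNr -mulrN -invrN divr_gt0// oppr_gt0.
  by exists (acos u); rewrite ca sa; split=> //; [rewrite divr_gt0|left].
set z := Num.sqrt (sin t / g 1 0); have z0 : 0 < z by rewrite sqrtr_gt0.
have zE : sin t = z ^+ 2 * g 1 0 by rewrite sqr_sqrtr ?ltW// divfK.
have z_neq0 : z != 0 by rewrite gt_eqF.
set x := (g 0 0 - g 1 1) / (2 * g 1 0).
have kdet : z * z^-1 - (x / z) * 0 = 1 by rewrite mulr0 subr0 divff.
exists (sl2 kdet), t; split => //; apply: (mulIg (sl2 kdet)); rewrite mulgVK.
have uE : u = (g 0 0 + g 1 1) / 2 by rewrite /u trSL2E.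
have qE : g 0 1 = - (g 0 0 * x + z ^+ 2 * sin t - x * u).
  apply: (mulfI r0); rewrite (_ : g 1 0 * - _ =
      - (g 0 0 * (g 1 0 * x) + sin t ^+ 2 - g 1 0 * x * u)).
    rewrite st (_ : g 1 0 * x = (g 0 0 - g 1 1) / 2); last by rewrite /x; field.
    by rewrite uE; lra.
  by rewrite zE; ring.
have sE : g 1 1 = u * 2 - g 0 0 by rewrite uE; field.
apply: SL2_ext; rewrite !mulSL2E !rotE !sl2E ct.
- by rewrite zE /x sE; field; rewrite z_neq0.
- by rewrite qE; field.
- by rewrite zE; field.
- by rewrite /x uE; field; rewrite z_neq0.
Qed.
(** Zero displacement means that [g] is multiplication by a complex number, and such maps
    commute. *)
Lemma displ_eq0_rot g t : displ g = 0 -> (g * rot t = rot t * g)%g.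
Proof.
move/eqP; rewrite sqrtr_eq0 => le0.
have : ((g 0 0 - g 1 1) / 2) ^+ 2 + ((g 1 0 + g 0 1) / 2) ^+ 2 == 0.
  by rewrite eq_le le0 addr_ge0 ?sqr_ge0.
rewrite paddr_eq0 ?sqr_ge0// !sqrf_eq0 => /andP[/eqP E1 /eqP E2].
have sE : g 1 1 = g 0 0 by lra.
have rE : g 1 0 = - g 0 1 by lra.
by apply: SL2_ext; rewrite !mulSL2E !rotE ?sE ?rE; ring.
Qed.

Lemma irrational_pi2 (t : R) :
  irrational (t / pi) -> irrational (t / (pi *+ 2)).
Proof.
move=> it [q _ qE]; apply: it; exists (q * 2) => //.
by rewrite rmorphM /= qE ratr_nat -(mulr_natr pi) invfM mulrA divfK.
Qed.

Lemma irrationalN (x : R) : irrational x -> irrational (- x).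
Proof.
move=> ix [q _ qE]; apply: ix; exists (- q) => //.
by rewrite rmorphN /= qE opprK.
Qed.

(** Conjugate [g] to [rot t] and let [H] be the conjugated closure of [S]. The angles whose
    rotations come from [S] form a subgroup of the reals containing t and 2 pi, hence dense, so [H]
    contains every rotation. The conjugate of [x] is not a rotation because it does not commute with
    [rot t]; maximality makes [H] everything. *)
Lemma irrational_elliptic_dense S g x :
  (forall h k, S h -> S k -> S (h * k^-1)%g) -> S g -> S x ->
  -2 < SL2_tr g < 2 -> irrational (acos (SL2_tr g / 2) / pi) ->
  (g * x <> x * g)%g -> forall y, closure S y.
Proof.
move=> SB Sg Sx trg irr gx y.
have S1 : S 1%g by rewrite -(mulgV g); exact: SB.
have SV h : S h -> S (h^-1)%g by move=> Sh; rewrite -[(h^-1)%g]mul1g; exact: SB.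
have SM h k : S h -> S k -> S (h * k)%g.
  by move=> Sh Sk; rewrite -[k]invgK; exact/SB/SV.
have [k [t [gE tE]]] := elliptic_conj_rot trg.
pose c h := (k * h * k^-1)%g.
have cM h l : c (h * l)%g = (c h * c l)%g by rewrite /c !mulgA mulgVK.
have cV h : c (h^-1)%g = ((c h)^-1)%g by rewrite /c !invgM invgK !mulgA.
have cK h : c (k^-1 * h * k)%g = h by rewrite /c !mulgA mulgV mul1g mulgK.
pose H := [set h | closure S (c h)].
suff HT : forall h, H h by rewrite -(cK y); exact: HT.
have irrt : irrational (t / (pi *+ 2)).
  apply: irrational_pi2; case: tE => -> //.
  by rewrite mulNr; exact: irrationalN.
have pi2_gt0 : 0 < pi *+ 2 :> R by rewrite pmulrn_lgt0// pi_gt0.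
apply: (@rot_maximal _ _ (k^-1 * x * k)%g).
- by move=> h l Hh Hl; rewrite /H /= cM; exact: closure_SL2M.
- move=> s; pose G := [set s | S (c (rot s))].
  have Gs : closure G s.
    apply: (@real_subgroup_dense _ _ t (pi *+ 2)) => //.
    + by move=> u v Gu Gv; rewrite /G /= rotD rotN cM cV; exact: SB.
    + by rewrite /G /= /c -gE.
    + by rewrite /G /= rot2pi /c mulg1 mulgV.
  apply: (closure_continuous (f := c \o rot)) Gs.
    move=> u; apply: continuous_comp; first exact: rot_continuous.
    exact: SL2_translation_continuous.
  by move=> u Gu; exact: subset_closure.
- by apply: subset_closure; rewrite cK.
- apply/eqP => /(displ_eq0_rot t) E; apply: gx.
  have cg : c (rot t) = g by [].
  by have := congr1 c E; rewrite (cM _ (rot t)) (cM (rot t)) cK cg.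
Qed.
End Density.


(** * Trace identities for the Dehn twists *)

Section TraceIdentities.
Context {R : realType}.
Implicit Types (P Q T : SL2 R).
Local Notation tr := (@SL2_tr R).

Lemma SL2_trVM P Q : tr (P^-1 * Q)%g = tr P * tr Q - tr (P * Q)%g.
Proof. by rewrite SL2_trM; ring. Qed.

(** For (P, Q, T) = (A, B, C), with tr(ABC) = tr D, this is the coordinate z' of the twist in X; for
    (B, C, A) it is x' of the twist in Y. The reduction uses that the conjugate of P by PQ is Q^-1 P
    Q. *)
Lemma tr_conjl P Q T :
  tr (T * ((P * Q)^-1 * P * (P * Q)))%g =
  tr P * tr T + tr Q * tr (P * Q * T)%g
  - tr (P * Q)%g * tr (Q * T)%g - tr (T * P)%g.
Proof.
transitivity (tr (Q^-1 * (P * Q * T))%g).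
  have -> : (T * ((P * Q)^-1 * P * (P * Q)) = T * Q^-1 * (P * Q))%g.
    by rewrite invgM !mulgA mulgVK.
  by rewrite SL2_trC [RHS]SL2_trC !mulgA.
rewrite SL2_trVM; have -> : (Q * (P * Q * T) = (Q * P) * (Q * T))%g.
  by rewrite !mulgA.
rewrite (SL2_trM (Q * P)%g) (SL2_trC Q P) invgM.
have -> : (P^-1 * Q^-1 * (Q * T) = P^-1 * T)%g by rewrite !mulgA mulgVK.
by rewrite SL2_trVM (SL2_trC P T); ring.
Qed.

(** The second new coordinate of the twist, expressed through the first. With X = PQ and P' = X^-1 P
    X, the conjugate X^-1 Q X equals P'^-1 X. *)
Lemma tr_conjr P Q T :
  tr (((P * Q)^-1 * Q * (P * Q)) * T)%g =
  tr P * tr (P * Q * T)%g + tr Q * tr T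
  - tr (P * Q)%g * tr (T * ((P * Q)^-1 * P * (P * Q)))%g - tr (Q * T)%g.
Proof.
set X := (P * Q)%g; set P' := (X^-1 * P * X)%g.
have trP' : tr P' = tr P by rewrite /P' SL2_trC mulgA mulgV mul1g.
have -> : (X^-1 * Q * X * T = P'^-1 * (X * T))%g.
  have QE : Q = (P^-1 * X)%g by rewrite /X mulKg.
  by rewrite {1}QE /P'; clearbody X; rewrite !invgM invgK !mulgA.
have P'X : (P' * X^-1 = Q^-1)%g.
  by rewrite /P' mulgK /X invgM mulgVK.
clearbody P' X; rewrite SL2_trVM trP' (SL2_trC P' (X * T)%g).
rewrite -(mulgA X) (SL2_trM X (T * P')%g).
have -> : tr (X^-1 * (T * P'))%g = tr (Q^-1 * T)%g.
  by rewrite SL2_trC [RHS]SL2_trC -mulgA P'X.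
by rewrite SL2_trVM; ring.
Qed.

(** For the inverse twist the order reverses: the conjugate of Q is P Q P^-1, so its coordinate
    comes out directly and that of P is computed from it. *)
Lemma tr_conjVr P Q T :
  tr ((P * Q * Q * (P * Q)^-1) * T)%g =
  tr P * tr (P * Q * T)%g + tr Q * tr T
  - tr (P * Q)%g * tr (T * P)%g - tr (Q * T)%g.
Proof.
transitivity (tr (P^-1 * (T * P * Q))%g).
  have -> : (P * Q * Q * (P * Q)^-1 * T = (P * Q) * (P^-1 * T))%g.
    by rewrite invgM !mulgA mulgK.
  by rewrite SL2_trC !mulgA.
rewrite SL2_trVM !mulgA; have -> : (P * T * P * Q = (P * T) * (P * Q))%g.
  by rewrite !mulgA.
rewrite (SL2_trM (P * T)%g) (SL2_trC P T) invgM.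
have -> : (T^-1 * P^-1 * (P * Q) = T^-1 * Q)%g by rewrite !mulgA mulgVK.
rewrite SL2_trVM (SL2_trC T Q).
have -> : tr (T * P * Q)%g = tr (P * Q * T)%g by rewrite -mulgA SL2_trC.
by ring.
Qed.

Lemma tr_conjVl P Q T :
  tr (T * (P * Q * P * (P * Q)^-1))%g =
  tr P * tr T + tr Q * tr (P * Q * T)%g
  - tr (P * Q)%g * tr ((P * Q * Q * (P * Q)^-1) * T)%g - tr (T * P)%g.
Proof.
set X := (P * Q)%g; set Q' := (X * Q * X^-1)%g.
have trQ' : tr Q' = tr Q by rewrite /Q' SL2_trC mulgA mulVg mul1g.
have <- : (X * Q'^-1 = X * P * X^-1)%g.
  have PE : P = (X * Q^-1)%g by rewrite /X mulgK.
  by rewrite PE /Q'; clearbody X; rewrite !invgM invgK !mulgA.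
have XQ' : (X^-1 * Q' = P^-1)%g.
  by rewrite /Q' -(mulgA X) mulKg /X invgM mulVKg.
clearbody Q' X; rewrite mulgA (SL2_trC _ Q'^-1%g) SL2_trVM trQ' (SL2_trC T X).
have -> : (Q' * (T * X) = Q' * T * X)%g by rewrite mulgA.
rewrite (SL2_trC (Q' * T)%g X) (SL2_trM X (Q' * T)%g).
have -> : (X^-1 * (Q' * T) = P^-1 * T)%g by rewrite mulgA XQ'.
by rewrite SL2_trVM (SL2_trC P T); ring.
Qed.
End TraceIdentities.


(** * Irreducibility from one elliptic element *)

Section Irreducible.
Context {R : realType}.

(** The characteristic polynomial has negative discriminant, so det(g - l) is nonzero, while
    multiplying (g - l) v = 0 by the adjugate gives det(g - l) v = 0. *)
Lemma elliptic_no_real_eigenvector (g : SL2 R) (v : 'rV[R]_2) (l : R) :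
  -2 < SL2_tr g < 2 -> v *m (g : 'M[R]_2)^T = l *: v -> v = 0.
Proof.
rewrite trSL2E => trg /rowP E; have gdet := detSL2E g.
have mE i : (v *m (g : 'M[R]_2)^T) 0 i = v 0 0 * g i 0 + v 0 1 * g i 1.
  rewrite mxE big_ord_recl big_ord1 !mxE.
  by congr (_ + v 0 _ * g i _); exact: val_inj.
have := E 0; have := E 1; rewrite !mE !mxE => E1 E0.
have tr2 : (g 0 0 + g 1 1) ^+ 2 < 4 by nra.
have l_neq : l ^+ 2 - (g 0 0 + g 1 1) * l + 1 != 0.
  by apply/eqP => l0; have := sqr_ge0 (2 * l - (g 0 0 + g 1 1)); lra.
apply/rowP => i; rewrite [RHS]mxE; apply: (mulfI l_neq); rewrite mulr0.
rewrite -gdet; case: (ord2P i) => ->.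
  transitivity
    ((g 1 1 - l) * (v 0 0 * g 0 0 + v 0 1 * g 0 1 - l * v 0 0)
     - g 0 1 * (v 0 0 * g 1 0 + v 0 1 * g 1 1 - l * v 0 1)); first by ring.
  by rewrite E0 E1; ring.
transitivity
  ((g 0 0 - l) * (v 0 0 * g 1 0 + v 0 1 * g 1 1 - l * v 0 1)
   - g 1 0 * (v 0 0 * g 0 0 + v 0 1 * g 0 1 - l * v 0 0)); first by ring.
by rewrite E0 E1; ring.
Qed.

(** An invariant line would be spanned by a real eigenvector of the elliptic element. Only 0 and the
    plane remain, and they complement each other. *)
Lemma elliptic_completely_reducible (rho : rep R) (p : pi1) :
  -2 < SL2_tr (rho p) < 2 -> completely_reducible rho.
Proof.
move=> trp U Uinv.
have [->|U0] := eqVneq U 0.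
  exists 1%:M; split; last by apply/mxdirect_addsP; rewrite cap0mx.
    by move=> q; exact: submx1.
  exact: adds0mx.
have Ufull : row_full U.
  have U2 := rank_leq_row U.
  rewrite /row_full eqn_leq U2 ltnNge; apply/negP => U1.
  have vU := nz_row_sub U.
  have v0 : nz_row U != 0 by rewrite nz_row_eq0.
  have Uv : (U <= nz_row U)%MS.
    rewrite -(mxrank_leqif_sup vU) eqn_leq mxrankS//=.
    by rewrite (leq_trans U1)// lt0n mxrank_eq0.
  have /sub_rVP[l vE] : (nz_row U *m (rho p : 'M[R]_2)^T <= nz_row U)%MS.
    exact: submx_trans (submx_trans (submxMr _ vU) (Uinv p)) Uv.
  by move/eqP: v0; apply; exact: elliptic_no_real_eigenvector vE.
exists 0; split; last by apply/mxdirect_addsP; rewrite capmx0.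
  by move=> q; exact: stable0mx.
apply: eqmx_trans (addsmx0 _ _) _; apply/eqmxP.
by rewrite submx1 sub1mx.
Qed.
End Irreducible.


(** * The twists on the axis y = z = 0 *)

Section AxisReps.
Context {R : realType}.
Implicit Types (a c x : R) (rho sigma : rep R).
Local Notation tr := (@SL2_tr R).

(** Complete reducibility is left out of the conditions; it is recovered from -2 < a < 2. The value
    [x] is free because the twist in Y moves it. *)
Definition axis_rep a c x : set (rep R) :=
  [set rho | boundary_traces rho = (a, a, c, - c) /\
             rep_coords rho = (x, 0, 0)].

Lemma axis_repP a c x rho : axis_rep a c x rho <->
  [/\ tr (rho gA) = a, tr (rho gB) = a, tr (rho gC) = c & tr (rho gD) = - c] /\
  [/\ tr (rho gA * rho gB)%g = x, tr (rho gB * rho gC)%g = 0 &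
      tr (rho gC * rho gA)%g = 0].
Proof.
rewrite /axis_rep /= /boundary_traces /rep_coords /loopX /loopY /loopZ !gmulfM.
by split=> [[[-> -> -> ->] [-> -> ->]]|[[-> -> -> ->] [-> -> ->]]].
Qed.

Lemma rep_relation rho : (rho gA * rho gB * rho gC * rho gD = 1)%g.
Proof. by rewrite -!gmulfM pi1_relation pi1_mor1. Qed.

Lemma axis_rep_trABC a c x rho : axis_rep a c x rho ->
  tr (rho gA * rho gB * rho gC)%g = - c.
Proof.
case/axis_repP => -[_ _ _ <-] _; rewrite -[RHS]SL2_trV; congr tr.
by apply: (mulIg (rho gD)); rewrite rep_relation mulVg.
Qed.

Lemma tr_conjg (g h : SL2 R) : tr (g^-1 * h * g)%g = tr h.
Proof. by rewrite SL2_trC mulgA mulgV mul1g. Qed.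

(** With traces (a, a, c, -c) the constants ac + bd and ad + bc vanish, so y = z = 0 persists. The
    action precomposes with the inverse automorphism, hence the conjugation by (AB)^-1. *)
Lemma axis_rep_tauX a c x rho : axis_rep a c x rho ->
  axis_rep a c x (rep_act tauX rho).
Proof.
move=> rhoP; have ABC := axis_rep_trABC rhoP.
case/axis_repP: rhoP => -[A B C D] [X Y Z].
have vX i : in_X i -> rep_act tauX rho (gen i) =
    ((rho gA * rho gB)^-1 * rho (gen i) * (rho gA * rho gB))%g.
  move=> iX; rewrite /= twistXVE /twist_gen iX invgK.
  by rewrite !gmulfM pi1_morV /loopX gmulfM.
have vN i : ~~ in_X i -> rep_act tauX rho (gen i) = rho (gen i).
  by move=> iX; rewrite /= twistXVE /twist_gen (negbTE iX).
apply/axis_repP.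
rewrite !(vX iA, vX iB, vN iC, vN iD) ?in_XE // !tr_conjg; split=> //.
have trA' := tr_conjl (rho gA) (rho gB) (rho gC).
rewrite A B C X Y Z ABC in trA'.
split.
- have -> : forall g h k : SL2 R, (g^-1 * h * g * (g^-1 * k * g) =
    g^-1 * (h * k) * g)%g by move=> g h k; rewrite !mulgA mulgK.
  by rewrite tr_conjg.
- by rewrite tr_conjr trA' A B C X Y ABC; ring.
- by rewrite trA'; ring.
Qed.

Lemma axis_rep_tauXV a c x rho : axis_rep a c x rho ->
  axis_rep a c x (rep_act (aut_opp tauX) rho).
Proof.
move=> rhoP; have ABC := axis_rep_trABC rhoP.
case/axis_repP: rhoP => -[A B C D] [X Y Z].
have vX i : in_X i -> rep_act (aut_opp tauX) rho (gen i) =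
    (rho gA * rho gB * rho (gen i) * (rho gA * rho gB)^-1)%g.
  move=> iX; rewrite /= twistXE /twist_gen iX.
  by rewrite !gmulfM pi1_morV /loopX gmulfM.
have vN i : ~~ in_X i -> rep_act (aut_opp tauX) rho (gen i) = rho (gen i).
  by move=> iX; rewrite /= twistXE /twist_gen (negbTE iX).
apply/axis_repP.
rewrite !(vX iA, vX iB, vN iC, vN iD) ?in_XE // !SL2_tr_conj; split=> //.
have trB' := tr_conjVr (rho gA) (rho gB) (rho gC).
rewrite A B C X Y Z ABC in trB'.
split.
- have -> : forall g h k : SL2 R, (g * h * g^-1 * (g * k * g^-1) =
    g * (h * k) * g^-1)%g by move=> g h k; rewrite !mulgA mulgVK.
  by rewrite SL2_tr_conj.
- by rewrite trB'; ring.
- by rewrite tr_conjVl trB' A B C X Z ABC; ring.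
Qed.

(** Here x' = ab + cd - yz - x = a^2 - c^2 - x, and the new z vanishes since ac + bd = 0. *)
Lemma axis_rep_tauY a c x rho : axis_rep a c x rho ->
  axis_rep a c (a ^+ 2 - c ^+ 2 - x) (rep_act tauY rho).
Proof.
move=> rhoP; have ABC := axis_rep_trABC rhoP.
have BCA : tr (rho gB * rho gC * rho gA)%g = - c by rewrite SL2_trC mulgA.
case/axis_repP: rhoP => -[A B C D] [X Y Z].
have vY i : in_Y i -> rep_act tauY rho (gen i) =
    ((rho gB * rho gC)^-1 * rho (gen i) * (rho gB * rho gC))%g.
  move=> iY; rewrite /= twistYVE /twist_gen iY invgK.
  by rewrite !gmulfM pi1_morV /loopY gmulfM.
have vN i : ~~ in_Y i -> rep_act tauY rho (gen i) = rho (gen i).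
  by move=> iY; rewrite /= twistYVE /twist_gen (negbTE iY).
apply/axis_repP.
rewrite !(vY iB, vY iC, vN iA, vN iD) ?in_YE // !tr_conjg; split=> //.
have trB' := tr_conjl (rho gB) (rho gC) (rho gA).
rewrite A B C X Y Z BCA in trB'.
split.
- by rewrite trB'; ring.
- have -> : forall g h k : SL2 R, (g^-1 * h * g * (g^-1 * k * g) =
    g^-1 * (h * k) * g)%g by move=> g h k; rewrite !mulgA mulgK.
  by rewrite tr_conjg.
- by rewrite tr_conjr trB' A B C Y Z BCA; ring.
Qed.

Lemma axis_rep_tauYV a c x rho : axis_rep a c x rho ->
  axis_rep a c (a ^+ 2 - c ^+ 2 - x) (rep_act (aut_opp tauY) rho).
Proof.
move=> rhoP; have ABC := axis_rep_trABC rhoP.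
have BCA : tr (rho gB * rho gC * rho gA)%g = - c by rewrite SL2_trC mulgA.
case/axis_repP: rhoP => -[A B C D] [X Y Z].
have vY i : in_Y i -> rep_act (aut_opp tauY) rho (gen i) =
    (rho gB * rho gC * rho (gen i) * (rho gB * rho gC)^-1)%g.
  move=> iY; rewrite /= twistYE /twist_gen iY.
  by rewrite !gmulfM pi1_morV /loopY gmulfM.
have vN i : ~~ in_Y i -> rep_act (aut_opp tauY) rho (gen i) = rho (gen i).
  by move=> iY; rewrite /= twistYE /twist_gen (negbTE iY).
apply/axis_repP.
rewrite !(vY iB, vY iC, vN iA, vN iD) ?in_YE // !SL2_tr_conj; split=> //.
have trC' := tr_conjVr (rho gB) (rho gC) (rho gA).
rewrite A B C X Y Z BCA in trC'.
split.
- by rewrite tr_conjVl trC' A B C X Y BCA; ring.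
- have -> : forall g h k : SL2 R, (g * h * g^-1 * (g * k * g^-1) =
    g * (h * k) * g^-1)%g by move=> g h k; rewrite !mulgA mulgVK.
  by rewrite SL2_tr_conj.
- by rewrite trC'; ring.
Qed.

Definition orbit_rep a c : set (rep R) :=
  axis_rep a c (a ^+ 2 - 2) `|` axis_rep a c (2 - c ^+ 2).

(** The induction carries [g] and its inverse together, as [mcg] is closed under inversion. *)
Lemma orbit_rep_mcg a c (g : pi1_aut) rho : mcg g -> orbit_rep a c rho ->
  orbit_rep a c (rep_act g rho) /\ orbit_rep a c (rep_act (aut_opp g) rho).
Proof.
(* The two x-values sum to a^2 - c^2, so the reflection induced by the twist in Y exchanges them. *)
have e1 : a ^+ 2 - c ^+ 2 - (a ^+ 2 - 2) = 2 - c ^+ 2 by ring.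
have e2 : a ^+ 2 - c ^+ 2 - (2 - c ^+ 2) = a ^+ 2 - 2 by ring.
move=> mg; elim: mg rho => {g}.
- by move=> rho; split.
- by move=> rho [] rhoP; split; [left|left|right|right];
    (exact: axis_rep_tauX || exact: axis_rep_tauXV).
- move=> rho [] rhoP; split; [right|right|left|left].
  + by rewrite -e1; exact: axis_rep_tauY.
  + by rewrite -e1; exact: axis_rep_tauYV.
  + by rewrite -e2; exact: axis_rep_tauY.
  + by rewrite -e2; exact: axis_rep_tauYV.
- move=> g h _ IHg _ IHh rho rhoP; split.
    exact: (IHg _ (IHh _ rhoP).1).1.
  exact: (IHh _ (IHg _ rhoP).2).2.
- by move=> g _ IHg rho rhoP; split; [exact: (IHg _ rhoP).2|
    exact: (IHg _ rhoP).1].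
Qed.
End AxisReps.


(** * Finiteness of the set of conjugacy classes *)

Definition inner (G : groupType) (g h : G) : G := (g * h * g^-1)%g.

Lemma innerM (G : groupType) (g : G) : {morph inner g : h k / (h * k)%g}.
Proof. by move=> h k; rewrite /inner !mulgA mulgVK. Qed.

HB.instance Definition _ (G : groupType) (g : G) :=
  isMultiplicative.Build G G (inner g) (innerM g).

Lemma gen_cases (i : 'I_4) : [\/ i = iA, i = iB, i = iC | i = iD].
Proof.
by case: i => [[|[|[|[|//]]]] ?]; [constructor 1|constructor 2|constructor 3|
  constructor 4]; apply: val_inj; rewrite /= inordK.
Qed.

Lemma finite_subset1 (T : Type) (A : set T) :
  (forall x y, A x -> A y -> x = y) -> finite_set A.
Proof.
move=> A1; have [[x Ax]|A0] := pselect (exists x, A x).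
  by apply: (sub_finite_set (B := [set x])) => // y Ay; exact: A1.
rewrite (_ : A = set0); first exact: finite_set0.
by apply/seteqP; split => // x Ax; apply: A0; exists x.
Qed.

Section Finiteness.
Context {R : realType}.
Implicit Types (a c x t u d : R) (rho sigma : rep R) (g k P Q : SL2 R).
Local Notation tr := (@SL2_tr R).

Lemma conj_rep_gen rho sigma g :
  sigma gA = inner g (rho gA) -> sigma gB = inner g (rho gB) ->
  sigma gC = inner g (rho gC) -> conj_rep rho sigma.
Proof.
move=> EA EB EC; exists g.
apply: (@pi1_mor_ext _ sigma (inner g \o rho)) => i.
case: (gen_cases i) => -> //=.
apply: (mulgI (sigma gA * sigma gB * sigma gC)%g).
by rewrite rep_relation EA EB EC -!innerM rep_relation /inner mulg1 mulgV.
Qed.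

(** After conjugating P to [rot t], the traces of Q and PQ determine the alpha coefficient of Q,
    because sin t is nonzero. It is e^(it), of modulus 1, so det Q = 1 forces beta = 0. *)
Lemma elliptic_eq P Q : -2 < tr P < 2 -> tr Q = tr P ->
  tr (P * Q)%g = tr P ^+ 2 - 2 -> Q = P.
Proof.
move=> trP trQ trPQ; have [k [t [PE tE]]] := elliptic_conj_rot trP.
set Q' := (k^-1 * Q * k)%g.
have QE : Q = (k * Q' * k^-1)%g by rewrite /Q' !mulgA mulgV mul1g mulgK.
clearbody Q'; rewrite QE PE; congr (k * _ * _)%g.
move: trP trQ trPQ; have -> : (P * Q = k * (rot t * Q') * k^-1)%g.
  by rewrite PE QE !mulgA mulgVK.
rewrite PE QE !SL2_tr_conj !trSL2E !mulSL2E !rotE.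
have Qdet := detSL2E Q'; have := cos2Dsin2 t.
set co := cos t; set si := sin t => cs tP tQ tPQ.
have si0 : si != 0.
  by apply/eqP => s0; move: cs tP; rewrite s0; clear; nra.
have rq : Q' 1 0 - Q' 0 1 = 2 * si.
  apply: (mulfI si0).
  have : co * (Q' 0 0 + Q' 1 1) = co * (co + co) by rewrite tQ.
  by lra.
have : (Q' 0 0 - Q' 1 1) ^+ 2 + (Q' 1 0 + Q' 0 1) ^+ 2 == 0.
  apply/eqP; transitivity ((Q' 0 0 + Q' 1 1) ^+ 2 + (Q' 1 0 - Q' 0 1) ^+ 2
    - 4 * (Q' 0 0 * Q' 1 1 - Q' 0 1 * Q' 1 0)); first by ring.
  by rewrite tQ rq Qdet; lra.
rewrite paddr_eq0 ?sqr_ge0// !sqrf_eq0 => /andP[/eqP E1 /eqP E2].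
by apply: SL2_ext; rewrite rotE -/co -/si; lra.
Qed.

Lemma tr_rot_hyp u d :
  tr (rot u * hyp d)%g = 2 * (Num.sqrt (1 + d ^+ 2) * cos u).
Proof. by rewrite trSL2E !mulSL2E !rotE !sl2E; ring. Qed.

Lemma tr_rot_hyp_rot u d t : tr (rot u * hyp d * rot t)%g =
  2 * (Num.sqrt (1 + d ^+ 2) * (cos u * cos t - sin u * sin t)).
Proof. by rewrite trSL2E !mulSL2E !rotE !sl2E; ring. Qed.

(** The two traces give w cos u and w sin u, hence w, then d by its sign, then the rotation. The
    angle itself is known only modulo 2 pi, so the matrices are compared. *)
Lemma rot_hyp_inj t u d u' d' : sin t != 0 -> 0 <= d -> 0 <= d' ->
  tr (rot u * hyp d)%g = tr (rot u' * hyp d')%g ->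
  tr (rot u * hyp d * rot t)%g = tr (rot u' * hyp d' * rot t)%g ->
  (rot u * hyp d = rot u' * hyp d')%g.
Proof.
move=> st d0 d'0; rewrite !tr_rot_hyp !tr_rot_hyp_rot.
have wE (b : R) : Num.sqrt (1 + b ^+ 2) ^+ 2 = 1 + b ^+ 2.
  by rewrite sqr_sqrtr// addr_ge0 ?sqr_ge0.
have w0 (b : R) : 0 < Num.sqrt (1 + b ^+ 2).
  by rewrite sqrtr_gt0 ltr_pwDl// sqr_ge0.
have := wE d; have := wE d'; have := w0 d; have := w0 d'.
set w := Num.sqrt (1 + d ^+ 2).
set w' := Num.sqrt (1 + d' ^+ 2) => w'_gt0 w_gt0 w'2 w2 E1 E2.
have {}E1 : w * cos u = w' * cos u' by lra.
have {}E2 : w * sin u = w' * sin u'.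
  apply: (mulfI st); rewrite !(mulrCA (sin t)).
  have := congr1 ( *%R^~ (cos t)) E1; rewrite -!mulrA => E3.
  by rewrite (mulrC (sin t)) (mulrC (sin t)); lra.
have ww' : w = w'.
  apply/eqP; rewrite -(eqrXn2 (n := 2)) ?ltW//; apply/eqP.
  transitivity ((w * cos u) ^+ 2 + (w * sin u) ^+ 2).
    by rewrite !exprMn -mulrDr cos2Dsin2 mulr1.
  by rewrite E1 E2 !exprMn -mulrDr cos2Dsin2 mulr1.
have dd' : d = d'.
  apply/eqP; rewrite -(eqrXn2 (n := 2)) //; apply/eqP.
  by apply: (addrI 1); rewrite -w2 -w'2 ww'.
have w_neq0 : w != 0 by rewrite gt_eqF.
rewrite -dd' in ww' *; rewrite -ww' in E1 E2.
have cu := mulfI w_neq0 E1; have su := mulfI w_neq0 E2.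
by congr (_ * _)%g; apply: SL2_ext; rewrite !rotE ?cu ?su.
Qed.

(** B is not recorded: over the root x = a^2 - 2 it equals A, and D follows from the relation. *)
Definition normal_rep t : set (rep R) :=
  [set rho | exists k u d, [/\ 0 <= d, rho gA = inner k (rot t) &
                               rho gC = inner k (rot u * hyp d)%g]].

(** Conjugating by a rotation fixes [rot t] and moves the right rotation of the Cartan decomposition
    of C to the left. *)
Lemma axis_rep_normal a c x rho : -2 < a < 2 -> axis_rep a c x rho ->
  normal_rep (acos (a / 2)) rho \/ normal_rep (- acos (a / 2)) rho.
Proof.
move=> a2 /axis_repP[[A _ _ _] _].
have trA : -2 < tr (rho gA) < 2 by rewrite A.
have [k [t [kA tE]]] := elliptic_conj_rot trA; rewrite A in tE.
suff : normal_rep t rho by case: tE => ->; [left|right].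
have [s [s' CE]] := cartan_decomposition (k^-1 * rho gC * k)%g.
set d := displ _ in CE.
exists (k * rot (- s'))%g, (s' + s), d; split; first exact: sqrtr_ge0.
  have rc : (rot (- s') * rot t = rot t * rot (- s'))%g.
    by rewrite -!rotD addrC.
  by rewrite /inner invgM -(mulgA k) rc !mulgA mulgK.
rewrite /inner invgM rotD rotN invgK !mulgA mulgVK.
by rewrite -(mulgA k) -(mulgA k) -CE !mulgA mulgV mul1g mulgK.
Qed.

Lemma axis_rep_classes_finite a c : -2 < a < 2 ->
  finite_set [set class_of rho | rho in axis_rep a c (a ^+ 2 - 2)].
Proof.
move=> a2; set X := axis_rep _ _ _.
have sin0 : sin (acos (a / 2)) != 0.
  rewrite sin_acos; last by lra.
  by rewrite gt_eqF// sqrtr_gt0; nra.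
(* Each of the two signs of the angle contributes at most one class. *)
have fin t : sin t != 0 ->
    finite_set [set class_of rho | rho in X `&` normal_rep t].
  move=> st; apply: finite_subset1 => m n.
  move=> [rho [rhoX [k [u [d [d0 A C]]]]] <-].
  move=> [sigma [sigmaX [k' [u' [d' [d'0 A' C']]]]] <-].
  have BA rho' : X rho' -> rho' gB = rho' gA.
    case/axis_repP => -[tA tB _ _] [tX _ _].
    by apply: elliptic_eq; rewrite ?tA ?tB ?tX.
  have CC : (rot u * hyp d = rot u' * hyp d')%g.
    move: rhoX sigmaX => /axis_repP[[_ _ tC _] [_ _ tZ]].
    move=> /axis_repP[[_ _ tC' _] [_ _ tZ']].
    move: tC tZ tC' tZ'; rewrite A C A' C' -!innerM /inner !SL2_tr_conj.
    by move=> tC tZ tC' tZ'; apply: (rot_hyp_inj st); rewrite ?tC ?tZ.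
  have inner_conj h : inner k' h = inner (k' * k^-1)%g (inner k h).
    by rewrite /inner invgM invgK !mulgA !mulgVK.
  apply/class_ofP; apply: (@conj_rep_gen _ _ (k' * k^-1)%g).
  - by rewrite A' A inner_conj.
  - by rewrite !BA// A' A inner_conj.
  - by rewrite C' C CC inner_conj.
apply: (sub_finite_set (B := _ `|` _)); last first.
  rewrite finite_setU; split; first exact: fin sin0.
  by apply: (fin (- acos (a / 2))); rewrite sinN oppr_eq0.
move=> _ [rho rhoX <-].
by case: (axis_rep_normal a2 rhoX) => N; [left|right]; exists rho.
Qed.

Lemma orbit_rep_classes_finite a c : -2 < a < 2 ->
  finite_set [set class_of rho | rho in orbit_rep a c].
Proof.
move=> a2; have fin := axis_rep_classes_finite c a2.
apply: (sub_finite_set (B := _ `|` act (aut_opp tauY) @` _)); last first.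
  by rewrite finite_setU; split; [exact: fin|apply: finite_image; exact: fin].
move=> _ [rho [rhoX|rhoX] <-]; [left; by exists rho|right].
(* A class over 2 - c^2 is the image under the inverse twist of a class over a^2 - 2. *)
exists (class_of (rep_act tauY rho)).
  exists (rep_act tauY rho) => //.
  by have := axis_rep_tauY rhoX; congr (axis_rep _ _ _ _); ring.
rewrite actE; apply/class_ofP; exists 1%g => p.
by rewrite mul1g invg1 mulg1 /= twistYK.
Qed.
End Finiteness.


(** * Existence, the compact component, noncommutation and density *)

Section Main.
Context {R : realType}.
Implicit Types (a c x t u d : R) (rho sigma : rep R) (g k : SL2 R).
Local Notation tr := (@SL2_tr R).

Lemma rep_of_generators g1 g2 g3 g4 : (g1 * g2 * g3 * g4 = 1)%g ->
  exists rho, [/\ rho gA = g1, rho gB = g2, rho gC = g3 & rho gD = g4].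
Proof.
move=> g1234; pose f (i : 'I_4) := nth 1%g [:: g1; g2; g3; g4] i.
have fE : (f iA = g1) * (f iB = g2) * (f iC = g3) * (f iD = g4).
  by do !split; rewrite /f inordK.
have fR : (f iA * f iB * f iC * f iD)%g = 1%g by rewrite !fE.
by exists (pi1_lift fR); rewrite /= !pi1_lift_gen !fE.
Qed.

(** [4 < a^2 + c^2] makes the quadratic in the entry [r] of the second matrix
    solvable at [s = 2c / (4 - a^2)]. *)
Lemma axis_pair_exists a c : -2 < a < 2 -> 4 < a ^+ 2 + c ^+ 2 ->
  exists g k : SL2 R, [/\ tr g = a, tr k = c & tr (g * k)%g = 0].
Proof.
move=> a2 ac; have a4 : 0 < 4 - a ^+ 2 by nra.
have a4_neq0 : 4 - a ^+ 2 != 0 by rewrite gt_eqF.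
set D := 4 * (a ^+ 2 + c ^+ 2 - 4) / (4 - a ^+ 2).
have D0 : 0 <= D by apply: divr_ge0; [lra|exact: ltW].
set s := 2 * c / (4 - a ^+ 2); set r := (a * s + Num.sqrt D) / 2.
have gdet : 0 * a - (-1) * 1 = 1 :> R by ring.
have kdet : (c - s) * s - (r - a * s) * r = 1.
  transitivity (c * s - s ^+ 2 + (a * s / 2) ^+ 2 - Num.sqrt D ^+ 2 / 4).
    by rewrite /r; field.
  by rewrite sqr_sqrtr// /D /s; field.
exists (sl2 gdet), (sl2 kdet).
by rewrite !trSL2E !mulSL2E !sl2E; split; ring.
Qed.

(** Take A = B = g, C = k and D = (ggk)^-1; then tr D = tr(g) tr(gk) - tr(k) = -c. *)
Lemma axis_rep_exists a c : -2 < a < 2 -> 4 < a ^+ 2 + c ^+ 2 ->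
  exists rho, axis_rep a c (a ^+ 2 - 2) rho.
Proof.
move=> a2 ac; have [g [k [tg tk tgk]]] := axis_pair_exists a2 ac.
have [|rho [A B C D]] := @rep_of_generators g g k ((g * g * k)^-1)%g.
  by rewrite mulgV.
exists rho; apply/axis_repP; rewrite A B C D tg tk SL2_trV (SL2_trC k g) tgk.
split; split=> //; last by rewrite SL2_trM mulVg SL2_tr1 tg; ring.
by rewrite -mulgA SL2_trM tg tgk mulKg tk; ring.
Qed.

Lemma orbit_rep_completely_reducible a c rho : -2 < a < 2 ->
  orbit_rep a c rho -> completely_reducible rho.
Proof.
move=> a2 rhoO; apply: (@elliptic_completely_reducible _ _ gA).
by case: rhoO => /axis_repP[[-> _ _ _] _].
Qed.

Lemma orbit_repE a c rho : orbit_rep a c rho <->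
  boundary_traces rho = (a, a, c, - c) /\
  (rep_coords rho = (a ^+ 2 - 2, 0, 0) \/ rep_coords rho = (2 - c ^+ 2, 0, 0)).
Proof.
split; first by case=> -[]; auto.
by case=> tB [] cO; [left|right].
Qed.

Lemma orbit_component a c : -2 < a < 2 -> -2 < c < 2 ->
  4 < a ^+ 2 + c ^+ 2 ->
  compact_component (a, a, c, - c) `&`
    coords @^-1` [set (a ^+ 2 - 2, 0, 0); (2 - c ^+ 2, 0, 0)] =
  [set class_of rho | rho in orbit_rep a c].
Proof.
move=> a2 c2 ac; apply/seteqP.
split=> [m [[[rho [_ tB] <-] _ _]]|_ [rho rhoO <-]].
  by rewrite /= coordsE => cO; exists rho => //; apply/orbit_repE.
have rhoR := orbit_rep_completely_reducible a2 rhoO.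
have := rhoO; rewrite orbit_repE => -[tB cO].
split; last by rewrite /= coordsE.
have sqrt_sqr u : -2 < u < 2 ->
    Num.sqrt ((u ^+ 2 - 4) * (u ^+ 2 - 4)) = 4 - u ^+ 2.
  by move=> u2; rewrite -expr2 sqrtr_sqr ltr0_norm; [ring|nra].
split; first by exists rho.
  by rewrite coordsE; case: cO => ->; rewrite /trace_cubic /=; ring.
(* The intervals are [a^2 - 2, 2] and [-2, 2 - c^2]. They are disjoint exactly when a^2 + c^2 > 4,
   and the two points are the endpoints of the gap. *)
by rewrite coordsE; case: cO => ->; rewrite /gap /= /Iplus /Iminus sqrrN
  !sqrt_sqr//; right; lra.
Qed.

Lemma act_bij_image (S : set (rep_class R)) (g : pi1_aut) :
  act g @` S `<=` S -> act (aut_opp g) @` S `<=` S -> act g @` S = S.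
Proof.
move=> gS gVS; apply/seteqP; split=> // m Sm.
exists (act (aut_opp g) m); first by apply: gVS; exists m.
have [rho ->] : exists rho, m = class_of rho.
  by exists (repr m); rewrite /class_of reprK.
rewrite !actE; apply/class_ofP; exists 1%g => p.
by rewrite mul1g invg1 mulg1 /= aut_invK.
Qed.

(** If g = A and k = C commuted, k (kgg) and (kg)^2 would have the same trace; these are 2 - a^2 -
    c^2 and -2. *)
Lemma orbit_noncommuting a c rho : 4 < a ^+ 2 + c ^+ 2 ->
  orbit_rep a c rho -> (rho gA * rho gC <> rho gC * rho gA)%g.
Proof.
move=> ac rhoO E.
have [tA tC tZ] : [/\ tr (rho gA) = a, tr (rho gC) = c &
    tr (rho gC * rho gA)%g = 0].
  by case: rhoO => /axis_repP[[? _ ? _] [_ _ ?]].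
move: (rho gA) (rho gC) E tA tC tZ => g k E tg tk tkg.
have : tr (k * (k * g * g))%g = tr ((k * g) * (k * g))%g.
  by congr tr; rewrite !mulgA -(mulgA k g k) E !mulgA.
have -> : tr (k * (k * g * g))%g = 2 - a ^+ 2 - c ^+ 2.
  have kgg : tr (k * g * g)%g = - c.
    by rewrite SL2_trC SL2_trM -E mulKg E tkg tk; ring.
  by rewrite SL2_trM kgg -mulgA mulKg (SL2_trM g) mulVg SL2_tr1 tk tg; ring.
rewrite (SL2_trM (k * g)%g) mulVg tkg SL2_tr1; lra.
Qed.

Lemma orbit_rep_dense a c rho : -2 < a < 2 -> -2 < c < 2 ->
  4 < a ^+ 2 + c ^+ 2 ->
  irrational (acos (a / 2) / pi) \/ irrational (acos (c / 2) / pi) ->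
  orbit_rep a c rho -> dense (range rho).
Proof.
move=> a2 c2 ac irr rhoO.
have AC := orbit_noncommuting ac rhoO.
have [tA tC] : tr (rho gA) = a /\ tr (rho gC) = c.
  by case: rhoO => /axis_repP[[? _ ? _] _].
have rangeB h k : range rho h -> range rho k -> range rho (h * k^-1)%g.
  by move=> [p _ <-] [q _ <-]; exists (p * q^-1)%g; rewrite // gmulfM pi1_morV.
have mem p : range rho (rho p) by exists p.
suff cl y : closure (range rho) y.
  move=> V [y Vy] oV; have [|z [rz Vz]] := cl y V; last by exists z.
  by apply: open_nbhs_nbhs; split.
case: irr => irr.
  by apply: (irrational_elliptic_dense rangeB (mem gA) (mem gC)); rewrite ?tA.
apply: (irrational_elliptic_dense rangeB (mem gC) (mem gA)); rewrite ?tC//.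
by move=> E; exact: AC.
Qed.
End Main.

Unset Implicit Arguments.
Set Strict Implicit.

Theorem mainTheorem3 (R : realType) (a c : R)
    (ha : -2 < a < 2) (hc : -2 < c < 2)
    (hac : a ^+ 2 + c ^+ 2 > 4)
    (hirr : irrational (acos (a / 2) / pi) \/ irrational (acos (c / 2) / pi)) :
  let B : R * R * R * R := (a, a, c, - c) in
  let O : set (R * R * R) :=
    [set (a ^+ 2 - 2, 0, 0); (2 - c ^+ 2, 0, 0)] in
  [/\ finite_set O,
      O `<=` [set coords m | m in compact_component B],
      forall g : pi1_aut, mcg g ->
        [set act g m | m in compact_component B `&` coords @^-1` O]
          = compact_component B `&` coords @^-1` O
    & forall rho : rep R, boundary_reps B rho ->
        O (coords (class_of rho)) ->
        dense (range rho) /\ finite_set (mcg_orbit (class_of rho))].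
Proof.
move=> B O; have compE := orbit_component ha hc hac.
rewrite -/B -/O in compE.
have classes_sub (g : pi1_aut) : mcg g -> forall rho, orbit_rep a c rho ->
    orbit_rep a c (rep_act g rho) /\ orbit_rep a c (rep_act (aut_opp g) rho).
  by move=> mg rho; exact: orbit_rep_mcg.
split.
- exact: finite_set2.
- have [rho rhoX] := axis_rep_exists ha hac.
  have sub sigma x : axis_rep a c x sigma -> orbit_rep a c sigma ->
      [set coords m | m in compact_component B] (x, 0, 0).
    move=> [_ <-] sigmaO; exists (class_of sigma); last exact: coordsE.
    suff : (compact_component B `&` coords @^-1` O) (class_of sigma) by case.
    by rewrite compE; exists sigma.
  move=> _ [->|->]; first by apply: (sub rho) => //; left.
  (* The second point is reached from the first by the twist in Y. *)
  have tauX' : axis_rep a c (2 - c ^+ 2) (rep_act tauY rho).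
    by have := axis_rep_tauY rhoX; congr (axis_rep _ _ _ _); ring.
  by apply: sub (tauX') _; right.
- move=> g mg; rewrite compE; apply: act_bij_image.
    move=> _ [_ [rho rhoO <-] <-]; rewrite actE; exists (rep_act g rho) => //.
    exact: (classes_sub g mg rho rhoO).1.
  move=> _ [_ [rho rhoO <-] <-]; rewrite actE.
  exists (rep_act (aut_opp g) rho) => //.
  exact: (classes_sub g mg rho rhoO).2.
- move=> rho [_ tB]; rewrite coordsE => cO.
  have rhoO : orbit_rep a c rho by apply/orbit_repE.
  split; first exact: (orbit_rep_dense ha hc hac hirr rhoO).
  apply: sub_finite_set (orbit_rep_classes_finite c ha).
  move=> _ [g mg <-]; rewrite actE; exists (rep_act g rho) => //.
  exact: (classes_sub g mg rho rhoO).1.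
Qed.
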